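(* Let $\ell\ge1$, let $\dot{\mathfrak g}$ be the simple complex Lie algebra of type $A_{2\ell}$, let $\sigma_0$ be the order 2 automorphism of $\dot{\mathfrak g}$ induced by the nontrivial diagram automorphism (permuting Chevalley generators accordingly; its fixed subalgebra is of type $B_\ell$, with $B_1=A_1$), and let $\sigma_1=\mathrm{id}$. Then the set $R$ of non-isotropic roots of the twisted 2-toroidal Lie algebra $\mathfrak g(\sigma_0,\sigma_1)$ is the extended affine root system $BC_\ell^{(2,1)}$: $$R=\{\alpha+m\delta_0+n\delta_1\mid\alpha\in R(B_\ell),\ m,n\in\mathbb Z\}\cup\{\alpha+(2m+1)\delta_0+n\delta_1\mid\alpha\in R(C_\ell)\text{ long},\ m,n\in\mathbb Z\}.$$ Here $R(B_\ell)$ is the root system of $\dot{\mathfrak g}_{(\overline0,\overline0)}$ with respect to its Cartan subalgebra $\dot{\mathfrak h}_{\overline0}$, and the long roots of $R(C_\ell)$ are the elements $2\alpha$ with $\alpha\in R(B_\ell)$ short.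
   Context: For $\ell=1$ all roots of $B_1=A_1$ are regarded as short. Work over $\mathbb C$. Let $\dot{\mathfrak g}$ be a simple finite-dimensional Lie algebra with Killing form $(\cdot,\cdot)$, and $\sigma_0,\sigma_1$ commuting automorphisms of finite orders $n_0,n_1$ (order 1 allowed). Put $\epsilon_j=\exp(2\pi i/n_j)$ and, for $p,q\in\mathbb Z$, $\dot{\mathfrak g}_{(\overline p,\overline q)}=\{g\in\dot{\mathfrak g}\mid\sigma_0(g)=\epsilon_0^p g,\ \sigma_1(g)=\epsilon_1^q g\}$, where $\overline p=p \bmod n_0$, $\overline q=q\bmod n_1$. Let $\mathcal R=\mathbb C[t_0^{\pm1},t_1^{\pm1}]$, $\mathcal K=\Omega^1_{\mathcal R}/d\mathcal R$, $k_i=t_i^{-1}dt_i$, and let $\mathcal K(\Sigma)\subset\mathcal K$ be spanned by the elements $t_0^{n_0a}t_1^{n_1b}k_i$ ($a,b\in\mathbb Z$, $i=0,1$). The twisted 2-toroidal Lie algebra is $$\mathfrak g(\sigma_0,\sigma_1)=\bigoplus_{m,n\in\mathbb Z}\dot{\mathfrak g}_{(\overline m,\overline n)}\otimes t_0^mt_1^n\ \oplus\ \mathcal K(\Sigma)\ \oplus\ \mathbb Cd_0\oplus\mathbb Cd_1,$$ with bracket $[g_1\otimes f_1,g_2\otimes f_2]=[g_1,g_2]\otimes f_1f_2+(g_1,g_2)f_2\,df_1$; $\mathcal K(\Sigma)$ commutes with itself and with all $g\otimes f$; $d_j=t_j\partial/\partial t_j$ acts by $[d_j,g\otimes t_0^{r_0}t_1^{r_1}]=r_j\,g\otimes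 t_0^{r_0}t_1^{r_1}$, $[d_j,t_0^{r_0}t_1^{r_1}k_i]=r_j\,t_0^{r_0}t_1^{r_1}k_i$; and $[d_0,d_1]=0$. Let $\dot{\mathfrak h}_{\overline 0}$ be a Cartan subalgebra of the reductive algebra $\dot{\mathfrak g}_{(\overline 0,\overline 0)}$ and $\mathfrak h=\dot{\mathfrak h}_{\overline 0}\oplus\mathbb Cd_0\oplus\mathbb Cd_1\oplus\mathbb Ck_0\oplus\mathbb Ck_1$. Elements of $\dot{\mathfrak h}_{\overline 0}^*$ are extended to $\mathfrak h$ by $0$ on all $d_i,k_i$; $\delta_i\in\mathfrak h^*$ is defined by $\delta_i(d_j)=\delta_{ij}$ and zero on $\dot{\mathfrak h}_{\overline 0}$ and all $k_j$. Let $V=\dot{\mathfrak h}_{\overline 0}^*\oplus\mathbb C\delta_0\oplus\mathbb C\delta_1$ with the bilinear form $(\cdot,\cdot)_V$ which on $\dot{\mathfrak h}_{\overline 0}^*$ is dual to the restriction of the Killing form to $\dot{\mathfrak h}_{\overline 0}$ and has $\delta_0,\delta_1$ in its radical. Then $R$ is the set of $\beta\in V$ with $(\beta,\beta)_V\ne0$ whose weight space in $\mathfrak g(\sigma_0,\sigma_1)$ under the adjoint action of $\mathfrak h$ is nonzero. *)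

(* Defs.v *)
From HB Require Import structures.
From mathcomp Require Import all_boot all_order all_algebra.
From mathcomp Require Import finmap monalg.
From mathcomp Require Import complex ring.
From mathcomp Require Import boolp classical_sets reals trigo.

Set Implicit Arguments.
Unset Strict Implicit.
Unset Printing Implicit Defensive.

Import Order.TTheory GRing.Theory Num.Theory.

Local Open Scope ring_scope.
Local Open Scope quotient_scope.

HB.mixin Record Vector_isLie (F : fieldType) L of Vector F L := {
  lie : L -> L -> L;
  lie_linearl : forall y, linear (lie^~ y);
  lie_linearr : forall x, linear (lie x);
  liexx : forall x, lie x x = 0;
  lie_jacobi : forall x y z,
    lie x (lie y z) + lie y (lie z x) + lie z (lie x y) = 0
}.

#[short(type="lieAlgType")]
HB.structure Definition LieAlg (F : fieldType) :=
  {L of Vector_isLie F L & Vector F L}.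

Section LieAlgebras.
Variables (F : fieldType) (L : lieAlgType F).
Implicit Types (x y : L) (U V G H : {vspace L}).

Definition ad x : 'End(L) := linfun (lie x).

Definition lfun_trace (f : 'End(L)) : F :=
  \tr (passmx.mxof (vbasis {:L}) (vbasis {:L}) f).

Definition killing x y : F := lfun_trace (ad x \o ad y)%VF.

Definition lie_automorphism (s : 'End(L)) : Prop :=
  bijective s /\ {morph s : x y / lie x y}.

Definition lie_prodv U V : {vspace L} :=
  <<[seq lie x y | x <- vbasis U, y <- vbasis V]>>%VS.

Definition lie_subalgebra H := (lie_prodv H H <= H)%VS.

Definition lower_central H k : {vspace L} := iter k (lie_prodv H) H.

Definition lie_nilpotent H := exists k, lower_central H k = 0%VS.

Definition self_normalizing G H :=
  forall x, x \in G -> (forall h, h \in H -> lie x h \in H) -> x \in H.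

Definition cartan_subalgebra G H : Prop :=
  [/\ (H <= G)%VS, lie_subalgebra H, lie_nilpotent H & self_normalizing G H].

Definition dual_space H := 'Hom(subvs_of H, F^o).

Definition lie_roots G H : set (dual_space H) :=
  [set a : dual_space H | a != 0 /\ exists x,
     [/\ x \in G, x != 0 &
         forall h : subvs_of H, lie (vsval h) x = (a h : F) *: x]].

(* The restriction of the Killing form to H, as a linear map H -> H^*. *)
Definition killing_to_dual H : 'Hom(subvs_of H, dual_space H) :=
  linfun (fun h => linfun (fun h' => killing (vsval h) (vsval h') : F^o)).

(* (a, b) = (t_a, t_b) = b t_a where (t_a, h) = a h for all h in H; this is
   meaningful when the Killing form of L is nondegenerate on H. *)
Definition dual_form H (a b : dual_space H) : F :=
  b ((killing_to_dual H)^-1%VF a).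

End LieAlgebras.

Arguments lie_roots {F L} G H.

Section SpecialLinear.
Variables (F : fieldType) (n : nat).

Definition sl_vs : {vspace 'M[F]_n} :=
  lker (linfun (fun A : 'M[F]_n => \tr A : F^o)).

Lemma mem_sl A : (A \in sl_vs) = (\tr A == 0).
Proof.
rewrite memv_ker; have lin : linear (fun A : 'M[F]_n => \tr A : F^o).
  by move=> a x y; rewrite mxtraceD mxtraceZ.
pose f := HB.pack (fun A : 'M[F]_n => \tr A : F^o)
  (GRing.isLinear.Build F 'M[F]_n F^o *:%R _ lin) : {linear 'M[F]_n -> F^o}.
by rewrite -[X in linfun X]/(f : _ -> _) lfunE.
Qed.

Definition sl := subvs_of sl_vs.
HB.instance Definition _ := Vector.copy sl (subvs_of sl_vs).

Lemma sl_val_inj (x y : sl) : vsval x = vsval y -> x = y.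
Proof. exact: val_inj. Qed.

Definition sl_lie (x y : sl) : sl :=
  vsproj sl_vs (vsval x *m vsval y - vsval y *m vsval x).

Lemma sl_lieE x y :
  vsval (sl_lie x y) = vsval x *m vsval y - vsval y *m vsval x.
Proof. by rewrite vsprojK // mem_sl linearB /= mxtrace_mulC subrr. Qed.

Lemma sl_valP a (x y : sl) : vsval (a *: x + y) = a *: vsval x + vsval y.
Proof. by []. Qed.

Lemma sl_valD (x y : sl) : vsval (x + y) = vsval x + vsval y.
Proof. by []. Qed.

Lemma sl_valN (x : sl) : vsval (- x) = - vsval x.
Proof. by []. Qed.

Lemma sl_lie_linearl y : linear (sl_lie^~ y).
Proof.
move=> a u v; apply: sl_val_inj; rewrite !(sl_valP, sl_lieE).
by rewrite mulmxDl mulmxDr -scalemxAl -scalemxAr scalerBr opprD addrACA.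
Qed.

Lemma sl_liexx x : sl_lie x x = 0.
Proof. by apply: sl_val_inj; rewrite sl_lieE subrr. Qed.

Lemma sl_lieC x y : sl_lie x y = - sl_lie y x.
Proof.
by apply: sl_val_inj; rewrite sl_valN !sl_lieE opprB.
Qed.

Lemma sl_lie_linearr x : linear (sl_lie x).
Proof.
move=> a u v; rewrite sl_lieC sl_lie_linearl opprD -scalerN.
by rewrite -!(sl_lieC x).
Qed.

Lemma sl_jacobi x y z :
  sl_lie x (sl_lie y z) + sl_lie y (sl_lie z x) + sl_lie z (sl_lie x y) = 0.
Proof.
apply: sl_val_inj.
rewrite !sl_valD !sl_lieE.
rewrite !mulmxBr !mulmxBl !mulmxA !opprB.
by do 6![move: (_ *m _ *m _) => ?]; apply/matrixP=> i j; rewrite !mxE; ring.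
Qed.

HB.instance Definition _ := Vector_isLie.Build F sl
  sl_lie_linearl sl_lie_linearr sl_liexx sl_jacobi.

End SpecialLinear.

(* Chevalley generators e_i = E_(i, i+1), f_i = E_(i+1, i) of sl_(n+1). *)
Definition chevalley_e (F : fieldType) n (i : 'I_n) : sl F n.+1 :=
  vsproj (sl_vs F n.+1) (delta_mx (widen_ord (leqnSn n) i) (lift ord0 i)).

Definition chevalley_f (F : fieldType) n (i : 'I_n) : sl F n.+1 :=
  vsproj (sl_vs F n.+1) (delta_mx (lift ord0 i) (widen_ord (leqnSn n) i)).

(* The automorphism of sl_(n+1) induced by the flip of the Dynkin diagram A_n;
   it is determined by its values on the generators e_i, f_i. *)
Definition diagram_automorphism (F : fieldType) n (s : 'End(sl F n.+1)) :=
  [/\ lie_automorphism s,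
      forall i : 'I_n, s (chevalley_e F i) = chevalley_e F (rev_ord i) &
      forall i : 'I_n, s (chevalley_f F i) = chevalley_f F (rev_ord i)].

(* Exponents (r_0, r_1) of the monomials t_0^r_0 t_1^r_1. *)
Definition expo := (int * int)%type.

(* The derivation t_j d/dt_j on V[t_0^+-1, t_1^+-1] for p the j-th projection
   of expo. *)
Definition degree_op (V : zmodType) (p : expo -> int) (f : {malg V[expo]}) :
  {malg V[expo]} := [malg r in msupp f => f@_r *~ p r].

Lemma degree_opE (V : zmodType) p (f : {malg V[expo]}) r :
  (degree_op p f)@_r = f@_r *~ p r.
Proof. by rewrite mcoeffE; case: msuppP => //; rewrite mul0rz. Qed.

Section Kaehler.
Variable F : fieldType.

Local Notation laurent := {malg F[expo]}.

(* Omega^1 of the Laurent polynomial ring is free on k_i = t_i^-1 dt_i; the pair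
   (w_0, w_1) stands for w_0 k_0 + w_1 k_1. *)
Definition omega1 := (laurent * laurent)%type.
HB.instance Definition _ := GRing.Lmodule.on omega1.

Definition kdiff (f : laurent) : omega1 := (degree_op fst f, degree_op snd f).

Definition exact_form : {pred omega1} :=
  [pred w | `[< exists f, w = kdiff f >]].

Lemma exact_formP w : reflect (exists f, w = kdiff f) (w \in exact_form).
Proof. exact: asboolP. Qed.

Lemma degree_op_linear p : linear (degree_op p : laurent -> laurent).
Proof.
move=> a f g; apply/malgP=> r.
by rewrite degree_opE mcoeffD mcoeffZ mcoeffD mcoeffZ !degree_opE;
  rewrite mulrzDl mulrzAr.
Qed.

Lemma kdiffZ a f g : kdiff (a *: f + g) = a *: kdiff f + kdiff g.
Proof. by rewrite /kdiff !degree_op_linear. Qed.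

Lemma kdiff0 : kdiff 0 = 0.
Proof. by congr pair; apply/malgP=> r; rewrite degree_opE mcoeff0 mul0rz. Qed.

Lemma exact_form_zmod_closed : zmod_closed exact_form.
Proof.
split=> [|w w'].
  apply/exact_formP; exists 0.
  by rewrite kdiff0.
move=> /exact_formP[f ->] /exact_formP[g ->]; apply/exact_formP.
by exists (-1 *: g + f); rewrite kdiffZ scaleN1r addrC.
Qed.

HB.instance Definition _ :=
  GRing.isZmodClosed.Build omega1 exact_form exact_form_zmod_closed.

(* The quotient of Omega^1 by the exact forms. *)
Definition kspace := Quotient.quot exact_form.
HB.instance Definition _ := GRing.Zmodule.on kspace.

Definition kpi (w : omega1) : kspace := \pi_(Quotient.quot exact_form) w.

Lemma kpiP w w' : kpi w = kpi w' <-> exists f, w - w' = kdiff f.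
Proof.
split=> [/eqP|[f E]].
  by rewrite -Quotient.idealrBE => /exact_formP.
by apply/eqP; rewrite -Quotient.idealrBE; apply/exact_formP; exists f.
Qed.

Lemma kpiD w w' : kpi (w + w') = kpi w + kpi w'.
Proof. exact: (Quotient.pi_add exact_form). Qed.

Definition kscale (a : F) (w : kspace) : kspace := kpi (a *: repr w).

Lemma kreprK (w : kspace) : kpi (repr w) = w.
Proof. exact: reprK. Qed.

Lemma kscaleE a w : kscale a (kpi w) = kpi (a *: w).
Proof.
have /kpiP[f E] := kreprK (kpi w).
apply/kpiP; exists (a *: f); rewrite -scalerBr E.
by rewrite -[a *: f]addr0 kdiffZ kdiff0 addr0.
Qed.

Lemma kscaleA a b w : kscale a (kscale b w) = kscale (a * b) w.
Proof. by rewrite -[w]kreprK !kscaleE scalerA. Qed.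

Lemma kscale1 w : kscale 1 w = w.
Proof. by rewrite -[w]kreprK kscaleE scale1r. Qed.

Lemma kscaleDr a w w' : kscale a (w + w') = kscale a w + kscale a w'.
Proof. by rewrite -[w]kreprK -[w']kreprK -kpiD !kscaleE -kpiD scalerDr. Qed.

Lemma kscaleDl w a b : kscale (a + b) w = kscale a w + kscale b w.
Proof. by rewrite -[w]kreprK !kscaleE -kpiD scalerDl. Qed.

HB.instance Definition _ := GRing.Zmodule_isLmodule.Build F kspace
  kscaleA kscale1 kscaleDr kscaleDl.

(* [d_j, w k_i] = (t_j dw/dt_j) k_i; this preserves exact forms. *)
Definition omega1_degree_op (p : expo -> int) (w : omega1) : omega1 :=
  (degree_op p w.1, degree_op p w.2).

Definition k_degree_op p (w : kspace) : kspace :=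
  kpi (omega1_degree_op p (repr w)).

Lemma k_degree_opE p w : k_degree_op p (kpi w) = kpi (omega1_degree_op p w).
Proof.
have /kpiP[f E] := kreprK (kpi w).
apply/kpiP; exists (degree_op p f); congr pair; apply/malgP=> r.
  have /malgP/(_ r) := congr1 fst E; rewrite /= !(mcoeffB, degree_opE) => /= E1.
  by rewrite -mulrzBl E1 mulrzAC.
have /malgP/(_ r) := congr1 snd E; rewrite /= !(mcoeffB, degree_opE) => /= E2.
by rewrite -mulrzBl E2 mulrzAC.
Qed.
End Kaehler.

Section Toroidal.
Variables (F : fieldType) (L : lieAlgType F).

(* L (x) F[t_0^+-1, t_1^+-1]; the coefficient of t^r is f@_r. *)
Definition loop := {malg L[expo]}.
HB.instance Definition _ := GRing.Zmodule.on loop.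

Definition loop_scale (a : F) (f : loop) : loop :=
  [malg r in msupp f => a *: f@_r].

Lemma loop_scaleE a (f : loop) r : (loop_scale a f)@_r = a *: f@_r.
Proof. by rewrite mcoeffE; case: msuppP => //; rewrite scaler0. Qed.

Lemma loop_scaleA a b f : loop_scale a (loop_scale b f) = loop_scale (a * b) f.
Proof. by apply/malgP=> r; rewrite !loop_scaleE scalerA. Qed.

Lemma loop_scale1 f : loop_scale 1 f = f.
Proof. by apply/malgP=> r; rewrite loop_scaleE scale1r. Qed.

Lemma loop_scaleDr a f g :
  loop_scale a (f + g) = loop_scale a f + loop_scale a g.
Proof. by apply/malgP=> r; rewrite !(mcoeffD, loop_scaleE) scalerDr. Qed.

Lemma loop_scaleDl f a b :
  loop_scale (a + b) f = loop_scale a f + loop_scale b f.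
Proof. by apply/malgP=> r; rewrite !(mcoeffD, loop_scaleE) scalerDl. Qed.

HB.instance Definition _ := GRing.Zmodule_isLmodule.Build F loop
  loop_scaleA loop_scale1 loop_scaleDr loop_scaleDl.

Definition loop_lie (f g : loop) : loop :=
  \sum_(r <- msupp f) \sum_(s <- msupp g) << lie f@_r g@_s *g (r + s)%R >>.

(* The class of the sum, over the terms x t^r of f and y t^s of g, of
   (x, y) t^s d(t^r) = (x, y) t^(r+s) (r_0 k_0 + r_1 k_1). *)
Definition loop_cocycle (f g : loop) : kspace F :=
  \sum_(r <- msupp f) \sum_(s <- msupp g)
    kpi (<< killing f@_r g@_s *~ r.1 *g (r + s)%R >>,
         << killing f@_r g@_s *~ r.2 *g (r + s)%R >>).

(* The actions of a_0 d_0 + a_1 d_1. *)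
Definition loop_deriv (a : F * F) (f : loop) : loop :=
  a.1 *: (degree_op fst f : loop) + a.2 *: (degree_op snd f : loop).

Definition k_deriv (a : F * F) (w : kspace F) : kspace F :=
  a.1 *: k_degree_op fst w + a.2 *: k_degree_op snd w.

(* The triple (f, w, (a_0, a_1)) stands for f + w + a_0 d_0 + a_1 d_1. *)
Definition toroidal := (loop * kspace F * (F^o * F^o))%type.
HB.instance Definition _ := GRing.Lmodule.on toroidal.

Definition toroidal_lie (X Y : toroidal) : toroidal :=
  let: (f, w, a) := X in
  let: (g, v, b) := Y in
  (loop_lie f g + loop_deriv a g - loop_deriv b f,
   loop_cocycle f g + k_deriv a v - k_deriv b w,
   0).

End Toroidal.

(* exp (2 pi i / n) *)
Definition root_of_unity (R : realType) (n : nat) : R[i] :=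
  (cos (2 * pi / n%:R) +i* sin (2 * pi / n%:R))%C.

Section TwistedToroidal.
Variables (R : realType) (L : lieAlgType R[i]).
Variables (s0 s1 : 'End(L)) (n0 n1 : nat).

Definition graded_part (p q : int) : {vspace L} :=
  (passmx.leigenspace s0 (root_of_unity R n0 ^ p)
     :&: passmx.leigenspace s1 (root_of_unity R n1 ^ q))%VS.

Definition kspace_sigma : set (kspace R[i]) :=
  [set kpi w | w in [set w : omega1 R[i] | forall r : expo,
     r \in msupp w.1 \/ r \in msupp w.2 -> (n0 %| r.1)%Z /\ (n1 %| r.2)%Z]].

Definition twisted_toroidal : set (toroidal L) :=
  [set X | (forall r : expo, X.1.1@_r \in graded_part r.1 r.2)
           /\ kspace_sigma X.1.2].

Variable H : {vspace L}.

(* H + C d_0 + C d_1 + C k_0 + C k_1; the element (h, (a_0, a_1), (c_0, c_1))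
   stands for h + a_0 d_0 + a_1 d_1 + c_0 k_0 + c_1 k_1. *)
Definition toroidal_cartan := (subvs_of H * (R[i] * R[i]) * (R[i] * R[i]))%type.

Definition cartan_incl (x : toroidal_cartan) : toroidal L :=
  let: (h, a, (c0, c1)) := x in
  (<< vsval h *g (0, 0) >>, kpi (<< c0 *g (0, 0) >>, << c1 *g (0, 0) >>), a).

(* V = H^* + C delta_0 + C delta_1. *)
Definition root_space := (dual_space H * (R[i]^o * R[i]^o))%type.
HB.instance Definition _ := GRing.Lmodule.on root_space.

Definition root_ext (a : dual_space H) : root_space := (a, (0, 0)).
Definition delta0 : root_space := (0, (1, 0)).
Definition delta1 : root_space := (0, (0, 1)).

Definition root_eval (b : root_space) (x : toroidal_cartan) : R[i] :=
  let: (h, (a0, a1), _) := x in b.1 h + b.2.1 * a0 + b.2.2 * a1.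

Definition root_space_form (b c : root_space) : R[i] := dual_form b.1 c.1.

Definition weight_space (b : root_space) : set (toroidal L) :=
  [set X | twisted_toroidal X /\ forall x : toroidal_cartan,
     toroidal_lie (cartan_incl x) X = root_eval b x *: X].

Definition nonisotropic_roots : set root_space :=
  [set b | root_space_form b b != 0 /\ exists2 X, weight_space b X & X != 0].

End TwistedToroidal.

(* Short means of minimal length, so that all roots are short when there is a
   single root length. *)
Definition short_roots (R : realType) (L : lieAlgType R[i]) (G H : {vspace L}) :
  set (dual_space H) :=
  [set a | lie_roots G H a /\
     forall b : dual_space H, lie_roots G H b ->
       dual_form a a <= dual_form b b].

Arguments short_roots {R L} G H.
Arguments nonisotropic_roots {R L} s0 s1 n0 n1 H.

(* Main.v *)
(** The automorphism s0 is X |-> - J X^T J, where J is antidiagonal with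
    alternating signs: both sides agree on the Chevalley generators. Its fixed
    points form the orthogonal Lie algebra of the symmetric form v J w^T.

    Let H be an arbitrary Cartan subalgebra of it. By Engel's argument H consists
    of all the fixed points on which every ad h acts nilpotently. Therefore the
    semisimple Jordan part of an element of H is in H and central in H, and H is
    the centralizer of the set T of its semisimple elements. In a basis of
    eigenvectors of T the weights are pairwise distinct: otherwise a wedge
    u |-> (u, v) w - (u, w) v of suitable vectors v and w of opposite weights would
    be semisimple and commute with T, that is, would be in T, but its eigenvalues
    would contradict the equality of weights. So the form pairs each basis vector
    i with exactly one vector tau i, where the involution tau has a single fixed
    point i0, and H is the set of diagonal matrices d with d (tau i) = - d i.

    With w_i the diagonal entries on H, the entry (i, j) has weight w_i - w_j, and
    s0 exchanges the entries (i, j) and (tau j, tau i) up to scalars. All the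
    nonzero w_i - w_j occur in the eigenspace of -1, and those with j <> tau i in
    that of 1. Since w_(tau i) = - w_i, the additional ones are the 2 w_i, and the
    Killing form, which is 2N tr (X Y), shows that the short roots are the
    nonzero w_i. *)

From HB Require Import structures.
Require Import Defs.
From mathcomp Require Import all_boot all_order all_algebra.
From mathcomp Require Import finmap monalg.
From mathcomp Require Import complex ring.
From mathcomp Require Import boolp classical_sets reals trigo.

Set Implicit Arguments.
Unset Strict Implicit.
Unset Printing Implicit Defensive.

Import Order.TTheory GRing.Theory Num.Theory.

Local Open Scope ring_scope.

(** * Iterates of commuting additive operators *)

Section IteratedOperators.

Lemma iter_comm (T : Type) (f g : T -> T) n x :
  (forall y, f (g y) = g (f y)) -> iter n f (g x) = g (iter n f x).
Proof. by move=> fg; elim: n => //= n ->. Qed.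

Lemma iter_morphD (V : zmodType) (f : V -> V) n x y :
  {morph f : a b / a + b} -> iter n f (x + y) = iter n f x + iter n f y.
Proof. by move=> fD; elim: n => //= n ->. Qed.

Lemma iter_fixed (T : Type) (f : T -> T) n x : f x = x -> iter n f x = x.
Proof. by move=> fx; elim: n => //= n ->. Qed.

(* The binomial argument: all the terms of (f + g)^(a + b) contain f^a or g^b. *)
Lemma iter_add_comm_eq0 (V : zmodType) (f g : V -> V) a b x :
  {morph f : y z / y + z} -> {morph g : y z / y + z} ->
  (forall y, f (g y) = g (f y)) ->
  iter a f x = 0 -> iter b g x = 0 ->
  iter (a + b) (fun y => f y + g y) x = 0.
Proof.
move=> fD gD fg; pose k y := f y + g y; rewrite -/k.
have f0 : f 0 = 0 by apply: (addrI (f 0)); rewrite -fD !addr0.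
have g0 : g 0 = 0 by apply: (addrI (g 0)); rewrite -gD !addr0.
have kD : {morph k : y z / y + z} by move=> y z; rewrite /k fD gD addrACA.
have k0 : k 0 = 0 by rewrite /k f0 g0 addr0.
move: {2}(a + b)%N (erefl (a + b)%N) => n; elim: n => [|n IHn] in a b x *.
  by case: a b => [|a] [|b].
move=> abn fx gx.
rewrite abn iterSr [k x]/k iter_morphD //.
have -> : iter n k (f x) = 0.
  case: a => [|a] in abn fx *; first by rewrite -[x]/(iter 0 f x) fx f0 iter_fixed.
  have {}abn : (a + b)%N = n by case: abn.
  by rewrite -abn; apply: IHn; rewrite // -?iterSr // iter_comm ?gx ?f0.
rewrite add0r.
case: b => [|b] in abn gx *; first by rewrite -[x]/(iter 0 g x) gx g0 iter_fixed.
have {}abn : (a + b)%N = n by move: abn; rewrite addnS; case.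
by rewrite -abn; apply: IHn; rewrite // -?iterSr // iter_comm ?fx ?g0.
Qed.

End IteratedOperators.

(** * Null elements for the adjoint action of a Cartan subalgebra *)

Section CartanNull.
Variables (F : fieldType) (L : lieAlgType F).
Implicit Types (x y z : L) (U V G H : {vspace L}).

HB.instance Definition _ x := GRing.isLinear.Build F L L _ (lie x)
  (lie_linearr x).

Lemma lie_addl x y z : lie (x + y) z = lie x z + lie y z.
Proof. by rewrite -[x]scale1r (lie_linearl z 1) !scale1r. Qed.

Lemma lie0l x : lie 0 x = 0.
Proof. by apply: (addrI (lie 0 x)); rewrite -lie_addl !addr0. Qed.

Lemma lieZl a x z : lie (a *: x) z = a *: lie x z.
Proof. by rewrite -[a *: x]addr0 (lie_linearl z) lie0l addr0. Qed.

Lemma lieC x y : lie x y = - lie y x.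
Proof.
have := liexx (x + y); rewrite lie_addl !linearD /= !liexx add0r addr0.
by move/eqP; rewrite addr_eq0 => /eqP.
Qed.

Lemma lie_suml (I : Type) (r : seq I) (P : pred I) (f : I -> L) y :
  lie (\sum_(i <- r | P i) f i) y = \sum_(i <- r | P i) lie (f i) y.
Proof.
by apply: (big_morph (lie^~ y)) => [u v|]; rewrite ?lie_addl ?lie0l.
Qed.

Lemma lie_leibniz x y z : lie x (lie y z) = lie (lie x y) z + lie y (lie x z).
Proof.
have := lie_jacobi x y z; rewrite (lieC z (lie x y)) (lieC z x) linearN /=.
by move/eqP; rewrite subr_eq0 => /eqP <-; rewrite addrNK.
Qed.

Lemma mem_lie_prodv U V x y : x \in U -> y \in V -> lie x y \in lie_prodv U V.
Proof.
move=> /coord_vbasis -> /coord_vbasis ->.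
rewrite lie_suml memv_suml // => i _; rewrite lieZl memvZ //.
rewrite linear_sum memv_suml //= => j _; rewrite linearZ memvZ //=.
by rewrite memv_span // allpairs_f // mem_nth ?size_tuple.
Qed.

Lemma lie_subalgebraP H :
  reflect {in H &, forall x y, lie x y \in H} (lie_subalgebra H).
Proof.
apply: (iffP idP) => [/subvP sHH x y xH yH|sHH].
  by rewrite sHH // mem_lie_prodv.
by apply/span_subvP=> _ /allpairsP[[x y]] /= [/vbasis_mem xH /vbasis_mem yH ->];
  apply: sHH.
Qed.

Lemma lower_centralS H k x y :
  x \in H -> y \in lower_central H k -> lie x y \in lower_central H k.+1.
Proof. exact: mem_lie_prodv. Qed.

Lemma lower_central_sub k H : lie_subalgebra H -> (lower_central H k <= H)%VS.
Proof.
move/lie_subalgebraP=> sHH; elim: k => //= k /subvP IHk.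
apply/span_subvP=> _ /allpairsP[[x y]] /= [/vbasis_mem xH /vbasis_mem yH ->].
by rewrite sHH // IHk.
Qed.

Lemma lie_nilpotent_ad H : lie_nilpotent H ->
  exists k, {in H &, forall x y, iter k (lie x) y = 0}.
Proof.
case=> k Hk; exists k => x y xH yH.
apply/eqP; rewrite -memv0 -Hk; elim: k {Hk} => //= k IHk.
exact: lower_centralS.
Qed.

(** Binomial argument for the derivation ad x: each term of (ad x)^(a + b) [y, z] contains (ad x)^a
    y or (ad x)^b z. *)
Lemma iter_lie_leibniz x y z a b :
  iter a (lie x) y = 0 -> iter b (lie x) z = 0 ->
  iter (a + b) (lie x) (lie y z) = 0.
Proof.
move: {2}(a + b)%N (erefl (a + b)%N) => n; elim: n => [|n IHn] in a b y z *.
  by case: a b => [|a] [|b] //= _ -> _; rewrite lie0l.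
move=> abn xy xz.
rewrite abn iterSr lie_leibniz iter_morphD => [|u v]; last by rewrite linearD.
have -> : iter n (lie x) (lie (lie x y) z) = 0.
  case: a => [|a] in abn xy *.
    by rewrite -[y]/(iter 0 (lie x) y) xy linear0 lie0l iter_fixed ?linear0.
  have {}abn : (a + b)%N = n by case: abn.
  by rewrite -abn; apply: IHn; rewrite // -?iterSr.
rewrite add0r.
case: b => [|b] in abn xz *.
  by rewrite -[z]/(iter 0 (lie x) z) xz !linear0 iter_fixed ?linear0.
have {}abn : (a + b)%N = n by move: abn; rewrite addnS; case.
by rewrite -abn; apply: IHn; rewrite // -?iterSr.
Qed.

(** The Fitting null component of the action of H; the exponent may depend on h. *)
Definition ad_null H x := forall h, h \in H -> exists k, iter k (lie h) x = 0.

Lemma ad_null_lie H c x : lie_nilpotent H -> c \in H ->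
  ad_null H x -> ad_null H (lie c x).
Proof.
move=> /lie_nilpotent_ad[k Hk] cH x0 h hH; have [m xm] := x0 h hH.
by exists (k + m)%N; apply: iter_lie_leibniz; rewrite ?Hk.
Qed.

(* Engel's argument on G / H without the quotient: the terms C of the lower
   central series of H are treated from the last one to the first one, and the
   elements of a basis of C, which commute modulo the next term, one at a time. *)
Lemma cartan_subalgebra_ad_null G H x : cartan_subalgebra G H ->
  {in H & G, forall h g, lie h g \in G} -> x \in G -> ad_null H x -> x \in H.
Proof.
case=> sHG subH nilH selfH HGG xG x0; apply: contraT => xnH.
(* From a counterexample in [N0] the descent produces others with [C, y] in H for larger and larger
   C; once C = H, self-normalization gives a contradiction. *)
pose inv (C : {vspace L}) y := forall c, c \in C -> lie c y \in H.
pose N0 y := [/\ y \in G, y \notin H & ad_null H y].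
have /lie_subalgebraP sHH := subH.
have subk k : {subset lower_central H k <= H}.
  exact/subvP/lower_central_sub.
(* Both conditions survive ad h: [c, [h, z]] = [[c, h], z] + [h, [c, z]], and [c, h] lies in the
   next term of the series, whose bracket with z is already in H. *)
have invE k (z h : L) cs :
    {subset cs <= lower_central H k} -> h \in lower_central H k ->
    inv (lower_central H k.+1) z -> (forall c, c \in cs -> lie c z \in H) ->
    inv (lower_central H k.+1) (lie h z)
    /\ (forall c, c \in cs -> lie c (lie h z) \in H).
  move=> scs hk zk zcs; have hH := subk k h hk.
  split=> c cC; rewrite lie_leibniz memvD //.
  - by rewrite zk // lower_centralS // (subk k.+1).
  - by rewrite sHH // zk.
  - by rewrite zk // lower_centralS // (subk k) // scs.
  - by rewrite sHH // zcs.
have step k y : N0 y -> inv (lower_central H k.+1) y ->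
    exists2 z, N0 z & inv (lower_central H k) z.
  move=> Ny yk; pose cs : seq L := vbasis (lower_central H k).
  have scs : {subset cs <= lower_central H k} by move=> c /vbasis_mem.
  suff [z Nz [_ zcs]] : exists2 z, N0 z & inv (lower_central H k.+1) z
      /\ (forall c, c \in cs -> lie c z \in H).
    exists z => // c /coord_vbasis ->; rewrite lie_suml memv_suml // => i _.
    by rewrite lieZl memvZ // zcs ?mem_nth ?size_tuple.
  elim: cs scs => [|h cs' IHcs] scs; first by exists y.
  have scs' : {subset cs' <= lower_central H k}.
    by move=> c ccs; apply: scs; rewrite in_cons ccs orbT.
  have [z Nz [zk zcs]] := IHcs scs'.
  have hk : h \in lower_central H k by rewrite scs ?mem_head.
  have hH := subk k h hk.
  have : exists m, iter m (lie h) z \in H.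
    by case: Nz => _ _ /(_ h hH)[m zm]; exists m; rewrite zm mem0v.
  (* The last iterate of ad h on z outside H replaces z: it is still a counterexample, and ad h
     sends it into H. *)
  case/ex_minnP=> -[|m] zmH mmin; first by case: Nz => _ /negP[].
  exists (iter m (lie h) z).
    split; last first.
    - elim: m {zmH mmin} => [|m IHm] /=; first by case: Nz.
      exact: ad_null_lie.
    - by apply: contraT; rewrite negbK => /mmin; rewrite ltnn.
    - elim: m {zmH mmin} => [|m IHm] /=; first by case: Nz.
      exact: HGG.
  suff [mk mcs] : inv (lower_central H k.+1) (iter m (lie h) z)
      /\ forall c, c \in cs' -> lie c (iter m (lie h) z) \in H.
    by split=> // c; rewrite inE => /predU1P[-> //|]; apply: mcs.
  elim: m {zmH mmin} => [//|m [IH1 IH2]] /=.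
  by apply: invE => // c ccs; rewrite scs // inE ccs orbT.
have [k Hk] := nilH.
have : exists2 y, N0 y & inv (lower_central H k) y.
  by exists x => // c; rewrite Hk memv0 => /eqP->; rewrite lie0l mem0v.
elim: k {Hk} => [|k IHk] [y Ny yk]; last by have := step k y Ny yk.
case: Ny => yG /negP[]; apply: selfH => // h hH.
by rewrite lieC memvN; apply: yk.
Qed.

End CartanNull.

(** * Jordan decomposition *)

Section JordanDecomposition.

(** Induction on the roots: the Bezout element [v * q] is 1 modulo the new (X - a)^m and 0 modulo
    the others, so a multiple of it corrects p at a alone. *)
Lemma chinese_remainder_XsubC (F : fieldType) (rs : seq F) m : uniq rs ->
  exists p : {poly F}, forall a, a \in rs -> ('X - a%:P) ^+ m %| p - a%:P.
Proof.
elim: rs => [|a rs IHrs] /=; first by exists 0.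
case/andP=> nars /IHrs[p Hp].
pose q := \prod_(b <- rs) ('X - b%:P) ^+ m.
have /Bezout_eq1_coprimepP[[u v] /= uv1] : coprimep (('X - a%:P) ^+ m) q.
  rewrite coprimep_expl // /q; elim: rs nars {IHrs Hp q} => [_|b rs IHrs].
    by rewrite big_nil coprimep1.
  rewrite inE negb_or big_cons coprimepMr => /andP[ab /IHrs->].
  by rewrite andbT coprimep_expr // coprimep_XsubC root_XsubC eq_sym.
exists (p + (a%:P - p) * (v * q)) => b; rewrite inE => /predU1P[->|brs].
  have -> : p + (a%:P - p) * (v * q) - a%:P = (p - a%:P) * u * ('X - a%:P) ^+ m.
    have -> : v * q = 1 - u * ('X - a%:P) ^+ m by rewrite -uv1 addrC addKr.
    ring.
  exact: dvdp_mull.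
rewrite addrAC dvdp_add ?Hp // !dvdp_mull //.
by rewrite /q (big_rem b) //= dvdp_mulr.
Qed.

Definition mxbracket (R : pzRingType) n (A B : 'M[R]_n) := A *m B - B *m A.

Variables (C : numClosedFieldType) (n : nat).
Implicit Types (A B S : 'M[C]_n.+1).

(* The polynomial is congruent to a modulo a large power of X - a for each
   eigenvalue a; it is made odd so that it preserves orthogonal Lie algebras. *)
Lemma jordan_decomposition_odd A : exists q : {poly C},
  [/\ q \Po (- 'X) = - q, diagonalizable (horner_mx A q)
    & exists k, (A - horner_mx A q) ^+ k = 0].
Proof.
have [r char_r] := closed_field_poly_normal (char_poly A).
(* The eigenvalues together with their negatives: with this symmetry the odd part q of p satisfies
   the same congruences as p. *)
pose rs := undup (r ++ map -%R r).
have rsN a : a \in rs -> - a \in rs.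
  rewrite !mem_undup !mem_cat => /orP[ar|/mapP[b br ->]]; last by rewrite opprK br.
  by rewrite map_f ?orbT.
(* No root has multiplicity above [size r], so rho^m is a multiple of the characteristic polynomial;
   as a successor, m is also positive. *)
pose m := (size r).+1; pose rho := \prod_(a <- rs) ('X - a%:P).
have char_rho : char_poly A %| rho ^+ m.
  rewrite char_r (monicP (char_poly_monic A)) scale1r exprS.
  have: {subset r <= rs} by move=> a ar; rewrite mem_undup mem_cat ar.
  move=> srs; rewrite dvdp_mull // {}/m {}/rho; move: (rs) srs => rs'.
  elim: (r) => [|a r' IHr] srs; first by rewrite big_nil dvd1p.
  rewrite big_cons exprS dvdp_mul //; last first.
    by apply: IHr => b br; rewrite srs // inE br orbT.
  by rewrite dvdp_XsubCl root_prod_XsubC srs ?mem_head.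
have rho0 p : rho ^+ m %| p -> horner_mx A p = 0.
  move=> /(dvdp_trans char_rho) /(dvdp_trans (mxminpoly_dvd_char A)).
  exact/mxminpoly_minP.
have [p Hp] := chinese_remainder_XsubC m (undup_uniq (r ++ map -%R r)).
pose q := 2^-1 *: (p - (p \Po (- 'X))).
have Hq a : a \in rs -> ('X - a%:P) ^+ m %| q - a%:P.
  move=> ars; have -> : q - a%:P
      = 2^-1 *: ((p - a%:P) - ((p - (- a)%:P) \Po (- 'X))).
    rewrite /q comp_polyB comp_polyC polyCN.
    apply: (scalerI (_ : 2 != 0 :> C)); rewrite ?pnatr_eq0 //.
    rewrite scalerBr !scalerA divff ?pnatr_eq0 // !scale1r.
    rewrite scaler_nat; ring.
  rewrite dvdpZr ?invr_eq0 ?pnatr_eq0 // dvdp_sub ?Hp //.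
  have /dvdpP[u ->] := Hp _ (rsN a ars).
  rewrite comp_polyM dvdp_mull // rmorphXn /= comp_polyB comp_polyX comp_polyC.
  rewrite polyCN opprK (_ : - 'X + a%:P = - ('X - a%:P)); last by ring.
  by rewrite exprNn dvdp_mull.
exists q; split.
- rewrite /q comp_polyZ comp_polyB -comp_polyA -scalerN opprB.
  by congr (_ *: (_ - _)); rewrite raddfN /= comp_polyX opprK comp_polyXr.
(* The product of the q - a is divisible by rho^m, so q(A) is annihilated by a polynomial with
   simple roots. *)
- apply/diagonalizableP; exists rs; first exact: undup_uniq.
  apply/mxminpoly_minP.
  have -> : horner_mx (horner_mx A q) (\prod_(x <- rs) ('X - x%:P))
      = horner_mx A (\prod_(x <- rs) (q - x%:P)).
    rewrite !rmorph_prod /=; apply: eq_bigr => a _.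
    by rewrite !rmorphB /= horner_mx_X !horner_mx_C.
  apply: rho0; rewrite -prodrXl.
  rewrite big_seq [X in _ %| X]big_seq.
  apply: (big_ind2 (fun u v : {poly C} => u %| v)) => [|u1 u2 v1 v2|a].
  - exact: dvdpp.
  - exact: dvdp_mul.
  - exact: Hq.
(* X - q vanishes at every a in [rs], hence is divisible by [rho], and its m-th power annihilates
   A. *)
- exists m; rewrite -{1}(horner_mx_X A) -rmorphB -rmorphXn /=; apply: rho0.
  rewrite dvdp_exp2r //; apply: uniq_roots_dvdp; last first.
    by rewrite uniq_rootsE undup_uniq.
  apply/allP=> a ars; rewrite -dvdp_XsubCl.
  have -> : 'X - q = ('X - a%:P) - (q - a%:P) by ring.
  by rewrite dvdp_sub // (dvdp_trans _ (Hq a ars)) // exprS dvdp_mulr.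
Qed.

(** In an eigenbasis of S, ad S multiplies the entry (i, j) by d_i - d_j; if a power of this factor
    kills an entry, so does the factor itself. *)
Lemma diagonalizable_ad_null S A k :
  diagonalizable S -> iter k (mxbracket S) A = 0 -> S *m A = A *m S.
Proof.
case=> P Pu /(similar_diagLR Pu)[d ->].
rewrite conjVmx // => Ak0.
pose K := P *m A *m invmx P.
have EA : A = invmx P *m K *m P by rewrite /K !mulmxA mulVmx // mul1mx mulmxKV.
pose D := diag_mx d.
have br B : mxbracket (invmx P *m D *m P) (invmx P *m B *m P)
    = invmx P *m mxbracket D B *m P.
  rewrite /mxbracket mulmxBr mulmxBl !mulmxA.
  by rewrite -!(mulmxA _ P (invmx P)) mulmxV // !mulmx1.
have iterE j : iter j (mxbracket (invmx P *m D *m P)) A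
    = invmx P *m iter j (mxbracket D) K *m P.
  by elim: j => //= j ->; rewrite br.
have entry j i1 i2 (B : 'M_n.+1) :
    iter j (mxbracket D) B i1 i2 = (d 0 i1 - d 0 i2) ^+ j * B i1 i2.
  elim: j => [|j IHj] /=; first by rewrite mul1r.
  by rewrite /mxbracket mul_diag_mx mul_mx_diag !mxE IHj exprS; ring.
have {iterE} K0 : iter k (mxbracket D) K = 0.
  move: Ak0; rewrite -/D iterE => /(congr1 (fun B => P *m B *m invmx P)).
  by rewrite !mulmxA mulmxV // mul1mx mulmxK // mulmx0 mul0mx.
suff : mxbracket D K = 0.
  move=> DK; have := br K; rewrite DK mulmx0 mul0mx -EA => /eqP.
  by rewrite subr_eq0 => /eqP.
apply/matrixP=> i j; have /matrixP/(_ i j) := K0.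
rewrite -[mxbracket D K]/(iter 1 (mxbracket D) K) !entry [RHS]mxE => /eqP.
rewrite [RHS]mxE mulf_eq0 expf_eq0 => /orP[/andP[_ /eqP->]|/eqP->].
  by rewrite expr1 mul0r.
by rewrite mulr0.
Qed.

(** ad A is the sum of two commuting nilpotent operators, left multiplication by A and minus right
    multiplication by A. *)
Lemma nilpotent_ad_null A k B : A ^+ k = 0 ->
  iter (k + k) (mxbracket A) B = 0.
Proof.
move=> Ak0.
apply: (iter_add_comm_eq0 (f := mulmx A) (g := fun X => - (X *m A))) => [X Y|X Y|X||].
- exact: mulmxDr.
- by rewrite mulmxDl opprD.
- by rewrite mulmxN mulmxA.
- have -> : iter k (mulmx A) B = A ^+ k *m B.
    elim: k {Ak0} => [|k IHk] /=; first by rewrite mul1mx.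
    by rewrite IHk exprS -mulmxE mulmxA.
  by rewrite Ak0 mul0mx.
- have -> : iter k (fun X => - (X *m A)) B = (-1) ^+ k *: (B *m A ^+ k).
    elim: k {Ak0} => [|k IHk] /=; first by rewrite scale1r mulmx1.
    by rewrite IHk exprS -scalemxAl -mulmxA mulmxE -exprSr mulN1r scaleNr.
  by rewrite Ak0 mulmx0 scaler0.
Qed.

Lemma mxbracketDl A B X : mxbracket (A + B) X = mxbracket A X + mxbracket B X.
Proof. by rewrite /mxbracket mulmxDl mulmxDr opprD addrACA. Qed.

Lemma mxbracketDr A X Y : mxbracket A (X + Y) = mxbracket A X + mxbracket A Y.
Proof. by rewrite /mxbracket mulmxDl mulmxDr opprD addrACA. Qed.

Lemma mxbracketN A X : mxbracket (- A) X = - mxbracket A X.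
Proof. by rewrite /mxbracket mulNmx mulmxN opprB opprK addrC. Qed.

Lemma mxbracket_comm A B X : A *m B = B *m A ->
  mxbracket A (mxbracket B X) = mxbracket B (mxbracket A X).
Proof.
move=> AB; rewrite /mxbracket !mulmxBr !mulmxBl !mulmxA AB.
rewrite -(mulmxA X B A) -AB mulmxA.
by do 4![move: (_ *m _ *m _) => ?]; apply/matrixP=> i j; rewrite !mxE; ring.
Qed.

(* ad S = ad A - ad (A - S), a difference of commuting operators. *)
Lemma jordan_semisimple_comm A q X k m :
    let S := horner_mx A q in
  diagonalizable S -> (A - S) ^+ m = 0 ->
  iter k (mxbracket A) X = 0 -> S *m X = X *m S.
Proof.
move=> S dS Am Xk; apply: (diagonalizable_ad_null (k := k + (m + m)) dS).
have comAS : A *m S = S *m A.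
  rewrite [LHS](_ : _ = horner_mx A ('X * q)); last first.
    by rewrite rmorphM /= horner_mx_X.
  by rewrite mulrC rmorphM /= horner_mx_X.
pose f := mxbracket A; pose g := mxbracket (- (A - S)).
have gE Y : g Y = - mxbracket (A - S) Y by rewrite /g mxbracketN.
rewrite (_ : iter _ _ _ = iter (k + (m + m)) (fun Y => f Y + g Y) X); last first.
  apply: eq_iter => Y; rewrite /f /g -mxbracketDl.
  by rewrite opprB addrCA subrr addr0.
apply: iter_add_comm_eq0 => //; rewrite /f /g.
- by move=> Y Z; rewrite mxbracketDr.
- by move=> Y Z; rewrite mxbracketDr.
- move=> Y; apply: mxbracket_comm.
  by rewrite mulmxN mulNmx mulmxBr mulmxBl comAS.
- apply: nilpotent_ad_null; rewrite exprNn Am; exact: mulr0.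
Qed.

End JordanDecomposition.

(** * The torus of an orthogonal Cartan subalgebra *)

Section Wedge.
Variables (C : numClosedFieldType) (n : nat) (J : 'M[C]_n.+1).
Hypothesis Jsym : J^T = J.
Implicit Types (v w : 'rV[C]_n.+1) (S X : 'M[C]_n.+1).

(* The Lie algebra of the bilinear form v J w^T on row vectors. *)
Definition so_form X := X *m J = - (J *m X^T).

Definition form v w : C := (v *m J *m w^T) 0 0.

(** The matrix of u |-> (u, v) w - (u, w) v on row vectors. *)
Definition wedge v w : 'M[C]_n.+1 := J *m v^T *m w - J *m w^T *m v.

Lemma formE v w : v *m J *m w^T = (form v w)%:M.
Proof. exact: mx11_scalar. Qed.

Lemma form_sym v w : form v w = form w v.
Proof.
rewrite /form [in RHS](_ : w *m J *m v^T = (v *m J *m w^T)^T).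
  by rewrite [RHS]mxE.
by rewrite !trmx_mul trmxK Jsym mulmxA.
Qed.

Lemma mul_wedge u v w : u *m wedge v w = form u v *: w - form u w *: v.
Proof. by rewrite /wedge mulmxBr !mulmxA !formE !mul_scalar_mx. Qed.

Lemma so_form_wedge v w : so_form (wedge v w).
Proof.
rewrite /so_form /wedge linearB /= !trmx_mul !trmxK Jsym.
by rewrite mulmxBl mulmxBr opprB !mulmxA.
Qed.

(** The wedge has the sum of the weights of v and w as its weight under ad S, and this sum is 0. *)
Lemma wedge_comm S v w a : S^T = S -> so_form S ->
  v *m S = a *: v -> w *m S = - a *: w -> S *m wedge v w = wedge v w *m S.
Proof.
move=> Ssym; rewrite /so_form Ssym => SJ vS wS.
have Sv : S *m v^T = a *: v^T by rewrite -Ssym -trmx_mul vS linearZ.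
have Sw : S *m w^T = - a *: w^T by rewrite -Ssym -trmx_mul wS linearZ.
rewrite /wedge mulmxBr mulmxBl -!mulmxA wS vS !(mulmxA S) SJ !mulNmx.
rewrite -!(mulmxA J) !(mulmxA S) Sv Sw -!scalemxAl -!scalemxAr !scaleNr.
by rewrite opprK addrC; congr (_ + _); rewrite -?scalemxAr ?scaleNr ?opprK.
Qed.

(** On the span of v and w the wedge squares to a scalar, minus the Gram determinant. *)
Lemma mul_wedge2 v w :
  v *m wedge v w *m wedge v w = (form v w ^+ 2 - form v v * form w w) *: v.
Proof.
rewrite (mul_wedge v) mulmxBl -!scalemxAl !mul_wedge (form_sym w v).
apply/rowP=> i; rewrite !mxE; ring.
Qed.

Lemma mul_wedge2r v w :
  w *m wedge v w *m wedge v w = (form v w ^+ 2 - form v v * form w w) *: w.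
Proof.
rewrite (mul_wedge w) mulmxBl -!scalemxAl !mul_wedge (form_sym w v).
apply/rowP=> i; rewrite !mxE; ring.
Qed.

(** With b the scalar by which W squares on the plane, W^3 = b W; since b is nonzero, X (X - r) (X +
    r) with r^2 = b has simple roots. *)
Lemma diagonalizable_wedge v w : form v w ^+ 2 != form v v * form w w ->
  diagonalizable (wedge v w).
Proof.
rewrite -subr_eq0; set b := _ - _ => bn0; set W := wedge v w.
have WE : W *m W *m W = b *: W.
  rewrite -[LHS]/((J *m v^T *m w - J *m w^T *m v) *m W *m W) !mulmxBl.
  rewrite -!(mulmxA (J *m _)) mul_wedge2 mul_wedge2r.
  by rewrite -!scalemxAr -scalerBr.
clearbody W; pose r := sqrtC b.
have rn0 : r != 0 by rewrite sqrtC_eq0.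
apply/diagonalizableP; exists [:: 0; r; - r].
  rewrite /= !inE !negb_or eq_sym rn0 eq_sym oppr_eq0 rn0 /= andbT.
  by rewrite -subr_eq0 opprK -mulr2n mulrn_eq0 negb_or rn0.
apply/mxminpoly_minP; rewrite unlock /= !rmorphM rmorph1 !rmorphB /=.
rewrite horner_mx_X !horner_mx_C mulr1 raddf0 subr0.
rewrite -!mulmxE mulmxBl !mulmxBr !mul_scalar_mx !mul_mx_scalar !mulmxA WE.
rewrite -!scalemxAr mul_mx_scalar scalerA mulrN -expr2 sqrtCK !scaleNr !opprK.
by rewrite [X in _ - X]addrC subrr.
Qed.

End Wedge.

(** * Weights of a torus in diagonal position *)

Section DiagonalTorus.
Variables (C : numClosedFieldType) (n : nat) (J : 'M[C]_n.+1).
Hypotheses (Jsym : J^T = J) (Junit : J \in unitmx).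
Variable H : 'M[C]_n.+1 -> Prop.
Implicit Types (S X : 'M[C]_n.+1) (v w : 'rV[C]_n.+1).

Let T S := H S /\ diagonalizable S.

Hypothesis H_so : forall X, H X -> so_form J X.
Hypothesis H_cent : forall X, so_form J X ->
  (forall S, T S -> S *m X = X *m S) -> H X.
Hypothesis T_cent : forall S X, T S -> H X -> S *m X = X *m S.
Hypothesis T_diag : forall S, T S -> is_diag_mx S.

Let e i : 'rV[C]_n.+1 := delta_mx 0 i.
(** The basis dual to the [e i] for the form; [u i] has the weight opposite to that of [e i]. *)
Let u i : 'rV[C]_n.+1 := e i *m invmx J.

Let eS S i : T S -> e i *m S = S i i *: e i.
Proof.
move=> /T_diag/is_diag_mxP Sd; rewrite -rowE; apply/rowP=> j; rewrite !mxE eqxx.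
by have [->|ji] := eqVneq j i; rewrite ?mulr1 // mulr0 Sd // eq_sym.
Qed.

Let S_sym S : T S -> S^T = S.
Proof.
move=> /T_diag/is_diag_mxP Sd; apply/matrixP=> i j; rewrite mxE.
by have [->//|ji] := eqVneq j i; rewrite !Sd // eq_sym.
Qed.

Let T_so S : T S -> so_form J S. Proof. by case=> /H_so. Qed.

Let uS S i : T S -> u i *m S = - S i i *: u i.
Proof.
move=> TS; rewrite /u -mulmxA.
have -> : invmx J *m S = - (S *m invmx J).
  have := T_so TS; rewrite /so_form S_sym // => SJ.
  rewrite -[LHS]mulmx1 -(mulmxV Junit) !mulmxA -(mulmxA (invmx J)) SJ.
  by rewrite mulmxN mulmxA mulVmx // mul1mx mulNmx.
by rewrite mulmxN mulmxA (eS _ TS) -scalemxAl scaleNr.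
Qed.

Let formeE i j : form J (e i) (e j) = J i j.
Proof. by rewrite /form -rowE trmx_delta -colE !mxE. Qed.

Let formeu i j : form J (e i) (u j) = (i == j)%:R.
Proof.
rewrite form_sym // /form /u mulmxKV // trmx_delta -colE !mxE eqxx /=.
by rewrite eq_sym.
Qed.

Let formDr v w w' : form J v (w + w') = form J v w + form J v w'.
Proof. by rewrite /form linearD /= mulmxDr mxE. Qed.

Let formNr v w : form J v (- w) = - form J v w.
Proof. by rewrite /form linearN /= mulmxN mxE. Qed.

(** Opposite weights make the wedge commute with T, so it lies in H; nondegeneracy of the plane
    makes it semisimple. *)
Let T_wedge i w : (forall S, T S -> w *m S = - S i i *: w) ->
  form J (e i) w ^+ 2 != J i i * form J w w -> T (wedge J (e i) w).
Proof.
move=> wS nd; have dW : diagonalizable (wedge J (e i) w).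
  by apply: diagonalizable_wedge; rewrite // formeE.
split=> //; apply: H_cent => [|S TS]; first exact: so_form_wedge.
apply: (@wedge_comm _ _ J S _ _ (S i i)); rewrite ?eS ?wS //.
- exact: S_sym.
- exact: T_so.
Qed.

Lemma J_weight S i j : T S -> J i j != 0 -> S j j = - S i i.
Proof.
move=> TS Jij; have := T_so TS; rewrite /so_form S_sym // => /matrixP/(_ i j).
have /is_diag_mxP Sd := T_diag TS.
rewrite !mxE (bigD1 i) //= big1 ?addr0; last first.
  by move=> k ki; rewrite Sd ?mul0r // eq_sym.
rewrite (bigD1 j) //= big1 ?addr0; last by move=> k kj; rewrite Sd ?mulr0.
by rewrite mulrC -mulrN => /(mulfI Jij) ->; rewrite opprK.
Qed.

(* A nondegenerate plane in the block of weight 0 would give a semisimple wedge,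
   hence an element of T, which does not vanish on that block. *)
Let zero_weight k w : (forall S, T S -> S k k = 0) ->
  (forall S, T S -> w *m S = 0) ->
  form J (e k) w ^+ 2 = J k k * form J w w.
Proof.
move=> k0 wS; apply/eqP; apply: contraT => nd.
have TW : T (wedge J (e k) w).
  by apply: T_wedge => // S TS; rewrite wS // k0 // oppr0 scale0r.
have := mul_wedge2 Jsym (e k) w.
rewrite eS // k0 // scale0r mul0mx => /esym/eqP.
rewrite scaler_eq0 formeE subr_eq0 (negPf nd) /= => /eqP/rowP/(_ k)/eqP.
by rewrite !mxE !eqxx oner_eq0.
Qed.

(** A common weight 0 is excluded by [zero_weight] applied to several vectors of the block; a common
    nonzero weight is excluded by a wedge in T with different diagonal entries at i and j. *)
Lemma weights_distinct i j : (forall S, T S -> S i i = S j j) -> i = j.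
Proof.
move=> Sij; apply/eqP; apply: contraT => nij.
have [i0|/existsNP[S /not_implyP[TS /eqP Si]]] :=
    pselect (forall S, T S -> S i i = 0).
  have j0 S : T S -> S j j = 0 by move=> TS; rewrite -Sij // i0.
  have u0 k S : k = i \/ k = j -> T S -> u k *m S = 0.
    by move=> [->|->] TS; rewrite uS ?i0 ?j0 // oppr0 scale0r.
  have := zero_weight i0 (fun S => u0 i S (or_introl erefl)).
  have := zero_weight j0 (fun S => u0 j S (or_intror erefl)).
  have := @zero_weight i (u i + u j) i0.
  have := @zero_weight i (u i - u j) i0.
  have uu S : T S -> (u i + u j) *m S = 0 /\ (u i - u j) *m S = 0.
    by move=> TS; rewrite mulmxDl mulmxBl !u0 ?addr0 ?subr0; auto.
  move=> /(_ (fun S TS => (uu S TS).2)) E1 /(_ (fun S TS => (uu S TS).1)) E2.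
  move: E1 E2; rewrite !(formDr, formNr) ![form J (_ + _) _]form_sym //.
  rewrite !(formDr, formNr) (form_sym Jsym (u j) (u i)) !formeu eqxx (negPf nij).
  rewrite eqxx.
  move: (form J (u i) (u i)) (form J (u j) (u j)) (form J (u i) (u j)) => x y z.
  rewrite /= subr0 addr0 !expr1n => E1 E2 E3 E4.
  (* Adding the relations for u_i + u_j and u_i - u_j eliminates z; with J_ii x = 1 this leaves J_ii
     y = 0, although [E4] and [E3] make both factors nonzero. *)
  have /eqP : J i i * y = 0.
    apply: (mulfI (_ : 2 != 0)); first by rewrite pnatr_eq0.
    have -> : 2 * (J i i * y) = J i i * (x - z - (z - y))
        + J i i * (x + z + (z + y)) - 2 * (J i i * x) by ring.
    by rewrite -E1 -E2 -E4; ring.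
  rewrite mulf_eq0 => /orP[]/eqP y0.
    by move: E4; rewrite y0 mul0r => /eqP; rewrite oner_eq0.
  by move: E3; rewrite y0 mulr0 => /eqP; rewrite oner_eq0.
have Jii : J i i = 0.
  apply/eqP; apply: contraT => /(J_weight TS)/eqP.
  by rewrite -subr_eq0 opprK -mulr2n mulrn_eq0 (negPf Si).
have Jji : J j i = 0.
  apply/eqP; apply: contraT => /(J_weight TS)/eqP.
  by rewrite -Sij // -subr_eq0 opprK -mulr2n mulrn_eq0 (negPf Si).
(* As e_i is isotropic and (e_i, u_i) = 1, the plane is nondegenerate; the wedge sends e_i to - e_i
   and e_j to 0. *)
have TW : T (wedge J (e i) (u i)).
  apply: T_wedge => [S' TS'|]; first exact: uS.
  by rewrite Jii mul0r formeu eqxx expr1n oner_eq0.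
have := Sij _ TW.
have -> : wedge J (e i) (u i) i i = -1.
  have := mul_wedge J (e i) (e i) (u i); rewrite eS // => /rowP/(_ i).
  by rewrite !mxE !eqxx formeE Jii formeu eqxx mul0r mulr1 mulr1 sub0r.
have -> : wedge J (e i) (u i) j j = 0.
  have := mul_wedge J (e j) (e i) (u i); rewrite eS // => /rowP/(_ j).
  rewrite !mxE !eqxx formeE Jji formeu eq_sym (negPf nij) !mul0r subr0.
  by rewrite mulr1.
by move/eqP; rewrite oppr_eq0 oner_eq0.
Qed.

(** Without fixed points, f would exchange the set of i < f i with its complement, and m would be
    even. *)
Lemma involution_fixpoint m (f : 'I_m -> 'I_m) : odd m -> involutive f ->
  exists i, f i = i.
Proof.
move=> om fK; apply: contrapT => /forallNP nofix.
pose A := [set i : 'I_m | (i < f i)%N].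
suff fA : f @: A = ~: A.
  have := cardsC A; rewrite -fA card_imset; last exact: inv_inj.
  by rewrite addnn card_ord => m2; rewrite -m2 odd_double in om.
apply/setP=> i; rewrite !inE -leqNgt; apply/imsetP/idP => [[k]|fi].
  by rewrite inE => kfk ->; rewrite fK ltnW.
exists (f i); rewrite ?fK // inE fK ltn_neqAle fi andbT.
by apply/eqP=> /val_inj /nofix.
Qed.

(** All j with J_ij nonzero have the weight opposite to i, hence coincide by distinctness: this
    defines tau. A fixed point exists by parity and has weight 0, so it is unique. An element of H
    commutes with T, whose weights are distinct, so it is diagonal. *)
Lemma diagonal_torus_structure : ~~ odd n ->
  exists tau : 'I_n.+1 -> 'I_n.+1, exists i0, [/\ involutive tau,
    forall i, (tau i == i) = (i == i0),
    forall i j, (J i j != 0) = (j == tau i) &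
    forall X, H X <->
      exists2 d : 'rV_n.+1, forall i, d 0 (tau i) = - d 0 i & X = diag_mx d].
Proof.
move=> en.
have Jrow i : exists j, J i j != 0.
  apply: contrapT => /forallNP J0.
  have /rowP/(_ i)/eqP : e i = 0.
    rewrite -[e i](mulmxK Junit) (_ : e i *m J = 0) ?mul0mx //.
    rewrite -rowE; apply/rowP=> j; rewrite !mxE; apply/eqP/negPn/negP.
    exact: J0.
  by rewrite !mxE !eqxx oner_eq0.
pose tau i := xchoose (Jrow i).
have Jtau i : J i (tau i) != 0 := xchooseP (Jrow i).
have tau_uniq i j : J i j != 0 -> j = tau i.
  move=> Jij; apply: weights_distinct => S TS.
  by rewrite (J_weight TS Jij) (J_weight TS (Jtau i)).
have JE i j : (J i j != 0) = (j == tau i).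
  by apply/idP/eqP => [/tau_uniq//|->].
have JC i j : J i j = J j i by rewrite -{1}Jsym mxE.
have tauK : involutive tau by move=> i; apply/esym/tau_uniq; rewrite JC.
have [i0 i0P] : exists i, tau i = i by apply: involution_fixpoint.
exists tau, i0; split=> // [i|X].
  apply/eqP/eqP => [ti|->//]; apply: weights_distinct => S TS.
  have fix0 k : tau k = k -> S k k = 0.
    move=> tk; have /eqP := J_weight TS (Jtau k).
    by rewrite tk -subr_eq0 opprK -mulr2n mulrn_eq0 => /eqP.
  by rewrite !fix0.
have entry (Y D : 'M[C]_n.+1) i j : is_diag_mx D ->
    ((D *m Y) i j = D i i * Y i j) * ((Y *m D) i j = Y i j * D j j).
  move=> /is_diag_mxP Dd; split; rewrite mxE.
    rewrite (bigD1 i) //= big1 ?addr0 // => k ki.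
    by rewrite Dd ?mul0r // eq_sym.
  by rewrite (bigD1 j) //= big1 ?addr0 // => k kj; rewrite Dd ?mulr0.
split=> [HX|[d dtau ->]].
  have Xd : is_diag_mx X.
    apply/is_diag_mxP=> i j ij; have nij : i != j by [].
    apply/eqP; apply: contraT => Xij; case/eqP: nij.
    apply: weights_distinct => S TS; have := T_cent TS HX.
    move/matrixP/(_ i j); rewrite !(entry X S i j (T_diag TS)) mulrC.
    exact: (mulfI Xij).
  exists (\row_i X i i) => [i|].
    rewrite !mxE; have := H_so HX; rewrite /so_form => /matrixP/(_ i (tau i)).
    have -> : X^T = X.
      apply/matrixP=> k k'; rewrite mxE; have [->//|kk'] := eqVneq k k'.
      by move/is_diag_mxP: Xd => Xd; rewrite !Xd // eq_sym.
    rewrite [RHS]mxE !(entry J X i (tau i) Xd) mulrC -mulrN => /(mulfI (Jtau i)) ->.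
    by rewrite opprK.
  apply/matrixP=> i j; rewrite !mxE; have [->|nij] := eqVneq i j.
    by rewrite mulr1n.
  by move/is_diag_mxP: Xd => ->; rewrite ?mulr0n.
apply: H_cent => [|S TS]; last first.
  have [s ->] := diag_mxP _ (T_diag TS); exact: diag_mxC.
rewrite /so_form tr_diag_mx; apply/matrixP=> i j.
rewrite [RHS]mxE !(entry J _ i j (diag_mx_is_diag d)) !mxE !eqxx !mulr1n.
have [Jij|] := eqVneq (J i j) 0; first by rewrite Jij mulr0 mul0r oppr0.
by rewrite JE => /eqP->; rewrite dtau mulrN opprK mulrC.
Qed.

End DiagonalTorus.

(** * Diagonalization of a Cartan subalgebra of an orthogonal Lie algebra *)

Section OrthogonalCartan.
Variables (C : numClosedFieldType) (n : nat) (J : 'M[C]_n.+1).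
Hypotheses (Jsym : J^T = J) (Junit : J \in unitmx).
Implicit Types X Y S P : 'M[C]_n.+1.

(** Moving J across X turns X into - X^T. For odd p it follows that p(X) stays in the orthogonal Lie
    algebra. *)
Lemma horner_so_form X p : so_form J X ->
  horner_mx X p *m J = J *m (horner_mx X (p \Po (- 'X)))^T.
Proof.
rewrite /so_form => XJ; elim/poly_ind: p => [|p c IHp].
  by rewrite comp_poly0 !rmorph0 trmx0 mul0mx mulmx0.
rewrite comp_polyD comp_polyM comp_polyX comp_polyC [X in J *m (_ (X + _))^T]mulrC.
rewrite !rmorphD !rmorphM /= rmorphN /= !horner_mx_X !horner_mx_C.
rewrite linearD /= mulmxDl mulmxDr tr_scalar_mx scalar_mxC; congr (_ + _).
by rewrite -!mulmxE trmx_mul linearN /= -mulmxA XJ !mulmxN !mulmxA IHp.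
Qed.

(** Provides the finite family needed for simultaneous diagonalization: a vector outside the current
    span is added until the codimension is exhausted. *)
Lemma finite_span (V : vectType C) (Q : V -> Prop) : exists s : seq V,
  (forall x, x \in s -> Q x) /\ (forall x, Q x -> x \in <<s>>%VS).
Proof.
suff gen m (s : seq V) : (\dim {:V} - \dim <<s>> <= m)%N ->
    (forall x, x \in s -> Q x) -> exists s : seq V,
    (forall x, x \in s -> Q x) /\ (forall x, Q x -> x \in <<s>>%VS).
  by apply: (gen (\dim {:V}) [::]) => [|x]; rewrite ?leq_subr ?in_nil.
elim: m s => [|m IHm] s dim_s sQ.
  exists s; split=> // x _.
  have /eqP -> : <<s>>%VS == {:V}%VS; last exact: memvf.
  by rewrite eqEdim subvf -subn_eq0 -leqn0.
have [|/existsNP[x /not_implyP[Qx /negP xs]]] :=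
    pselect (forall x, Q x -> x \in <<s>>%VS); first by exists s.
apply: (IHm (x :: s)) => [|y]; last first.
  by rewrite inE => /predU1P[->|/sQ].
have lt_s : (\dim <<s>> < \dim <<x :: s>>)%N.
  rewrite ltnNge; apply: contra xs => le_s.
  have sub : (<<s>> <= <<x :: s>>)%VS by rewrite span_cons addvSr.
  have /eqP -> : <<s>>%VS == <<x :: s>>%VS by rewrite eqEdim sub.
  by rewrite memv_span ?mem_head.
rewrite -ltnS; apply: leq_trans dim_s; apply: ltn_sub2l => //.
exact: leq_trans lt_s (dimvS (subvf _)).
Qed.

Variable H : 'M[C]_n.+1 -> Prop.
Hypothesis H_so : forall X, H X -> so_form J X.
Hypothesis H_nil : exists k, forall X Y, H X -> H Y ->
  iter k (mxbracket X) Y = 0.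
Hypothesis H_null : forall X, so_form J X ->
  (forall Y, H Y -> exists k, iter k (mxbracket Y) X = 0) -> H X.

Let T S := H S /\ diagonalizable S.

Lemma torus_central S X : T S -> H X -> S *m X = X *m S.
Proof.
case=> HS dS HX; have [k Hk] := H_nil.
exact: (diagonalizable_ad_null dS (Hk _ _ HS HX)).
Qed.

(** The semisimple part commutes with whatever a power of ad X kills, thus with H, and oddness of q
    keeps it orthogonal; [H_null] then puts it in H. *)
Lemma jordan_in_cartan X : H X ->
  exists S, T S /\ exists k, (X - S) ^+ k = 0.
Proof.
move=> HX; have [q [qN dq nq]] := jordan_decomposition_odd X.
exists (horner_mx X q); split=> //; split=> //; apply: H_null => [|Y HY].
  rewrite /so_form horner_so_form ?qN; last exact: H_so.
  by rewrite raddfN /= linearN /= mulmxN.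
exists 1; rewrite /= /mxbracket.
have [k Hk] := H_nil; have [m Xm] := nq.
by rewrite (jordan_semisimple_comm dq Xm (Hk _ _ HX HY)) subrr.
Qed.

(** Let S be the semisimple part of Y in H. It commutes with X and with Y, so on X the iterates of
    ad Y are those of the nilpotent ad (Y - S). *)
Lemma cartan_torus_centralizer X : so_form J X ->
  (forall S, T S -> S *m X = X *m S) -> H X.
Proof.
move=> soX cX; apply: H_null => // Y HY.
have [S [TS [k YSk]]] := jordan_in_cartan HY.
exists (k + k)%N; rewrite -(nilpotent_ad_null X YSk).
have SY := torus_central TS HY.
suff comS m : S *m iter m (mxbracket (Y - S)) X
    = iter m (mxbracket (Y - S)) X *m S.
  elim: (k + k)%N => //= m ->; set Z := iter m _ X.
  rewrite {2}/mxbracket mulmxBl mulmxBr comS -/Z /mxbracket opprB.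
  by rewrite addrA subrK.
elim: m => [|m IHm] /=; first exact: cX.
set Z := iter m _ X in IHm *.
have YS : (Y - S) *m S = S *m (Y - S) by rewrite mulmxBl mulmxBr SY.
move: (Y - S) YS Z IHm => W WS Z SZ.
rewrite /mxbracket mulmxBr mulmxBl -(mulmxA W) -SZ !mulmxA WS.
by rewrite -(mulmxA Z W) WS !mulmxA SZ.
Qed.

Lemma cartan_codiagonalizable : exists2 P, P \in unitmx &
  forall S, T S -> is_diag_mx (P *m S *m invmx P).
Proof.
have [s [sT Ts]] := finite_span T.
have /codiagonalizableP[P Pu /allP sP] :
    {in s &, forall f g, comm_mx f g} /\ (forall f, f \in s -> diagonalizable f).
  split=> [f g /sT Tf /sT Tg|f /sT[] //].
  by apply: torus_central => //; case: Tg.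
exists P => // S /Ts; rewrite -[s]in_tupleE => /coord_span ->.
rewrite mulmx_sumr mulmx_suml; apply/is_diag_mxP=> i j ij; rewrite summxE.
apply: big1 => k _; rewrite -scalemxAr -scalemxAl mxE.
have := sP _ (mem_nth 0 (ltn_ord k)).
by move=> /(similar_diagP _ Pu) ->; rewrite ?mulr0.
Qed.

Theorem orthogonal_cartan_structure : ~~ odd n ->
  exists P, exists tau : 'I_n.+1 -> 'I_n.+1, exists i0, [/\ P \in unitmx,
    involutive tau,
    forall i, (tau i == i) = (i == i0),
    forall i j, ((P *m J *m P^T) i j != 0) = (j == tau i) &
    forall X, H X <-> exists2 d : 'rV_n.+1,
      forall i, d 0 (tau i) = - d 0 i & P *m X *m invmx P = diag_mx d].
Proof.
move=> en; have [P Pu Pdiag] := cartan_codiagonalizable.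
(* In the basis of the rows of P the form has Gram matrix J' and the algebra becomes H', so the
   diagonal case applies. *)
pose J' := P *m J *m P^T; pose H' X := H (invmx P *m X *m P).
have iPu : invmx P \in unitmx by rewrite unitmx_inv.
have cjK X : invmx P *m (P *m X *m invmx P) *m P = X.
  by rewrite !mulmxA mulVmx // mul1mx mulmxKV.
have cjVK X : P *m (invmx P *m X *m P) *m invmx P = X.
  by rewrite !mulmxA mulmxV // mul1mx mulmxK.
have cjM X Y : invmx P *m (X *m Y) *m P
    = (invmx P *m X *m P) *m (invmx P *m Y *m P).
  by rewrite !mulmxA mulmxK.
have J'sym : J'^T = J' by rewrite /J' !trmx_mul trmxK Jsym mulmxA.
have J'unit : J' \in unitmx by rewrite !unitmx_mul Pu Junit unitmx_tr.
have so_cj X : so_form J' X <-> so_form J (invmx P *m X *m P).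
  have E : invmx P *m (X *m J') = (invmx P *m X *m P *m J) *m P^T.
    by rewrite /J' !mulmxA.
  have E' : invmx P *m (J' *m X^T) = (J *m (invmx P *m X *m P)^T) *m P^T.
    by rewrite /J' !trmx_mul !mulmxA mulVmx // mul1mx trmx_inv mulmxKV ?unitmx_tr.
  rewrite /so_form; split=> [XJ|XJ].
    have PTu : P^T \in unitmx by rewrite unitmx_tr.
    by apply: (can_inj (mulmxK PTu)); rewrite -E XJ mulmxN E' mulNmx.
  apply: (can_inj (mulKmx iPu)).
  by rewrite mulmxN E E' XJ mulNmx.
have dgcj Q X : Q \in unitmx -> diagonalizable X -> diagonalizable (conjmx Q X).
  move=> Qu /(diagonalizableP X).1[rs urs Xrs].
  by apply: (diagonalizableP (conjmx Q X)).2; exists rs; rewrite ?mxminpoly_uconj.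
have [|X soX cX|S X TS|S TS||tau [i0 [tauK tau0 J'E H'E]]] :=
    @diagonal_torus_structure C n J' J'sym J'unit H'.
- by move=> X /H_so/so_cj.
- apply: cartan_torus_centralizer => [|S [HS dS]]; first exact/so_cj.
  rewrite -[S]cjK -!cjM cX //; split; first by rewrite /H' cjK.
  by rewrite -conjumx //; apply: dgcj.
- case: TS => HS dS HX; rewrite -[S *m X]cjVK -[X *m S]cjVK !cjM.
  congr (P *m _ *m invmx P); apply: torus_central => //; split=> //.
  by rewrite -conjVmx //; apply: dgcj.
- case: TS => HS dS; rewrite -[S]cjVK; apply: Pdiag; split=> //.
  by rewrite -conjVmx //; apply: dgcj.
- exact: en.
exists P, tau, i0; split=> // X; split=> [HX|[d dN PX]].
  have /H'E[d dN PX] : H' (P *m X *m invmx P) by rewrite /H' cjK.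
  by exists d.
by rewrite -[X]cjK; apply/H'E; exists d.
Qed.

End OrthogonalCartan.

(** * The Killing form of sl_n *)

Section MatrixTrace.
Import passmx.

(** Reduces a trace on a retract V to a trace on all matrices, for g that extends f and has its
    image in V: f is the product A (g B), and cyclicity gives g B A = g. The double sum is the trace
    of g. *)
Lemma mxtrace_mxof_retract (F : fieldType) (V : vectType F) n
    (b : (\dim {:V}).-tuple V) (f : 'End(V))
    (i : {linear V -> 'M[F]_n}) (p : {linear 'M[F]_n -> V})
    (g : {linear 'M[F]_n -> 'M[F]_n}) : basis_of {:V} b ->
  cancel i p -> (forall x, g (i x) = i (f x)) -> (forall A, i (p (g A)) = g A) ->
  \tr (passmx.mxof b b f) = \sum_j \sum_k g (delta_mx j k) j k.
Proof.
move=> bb ip gi ipg.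
pose A := lin1_mx (mxvec \o i \o passmx.vecof b).
pose B := lin1_mx (passmx.rVof b \o p \o vec_mx).
have AE u : u *m A = mxvec (i (passmx.vecof b u)) by rewrite mul_rV_lin1.
have BE u : u *m B = passmx.rVof b (p (vec_mx u)) by rewrite mul_rV_lin1.
have -> : passmx.mxof b b f = A *m (lin_mx g *m B).
  apply/row_matrixP=> j; rewrite !rowE passmx.mul_mxof mulmxA AE mulmxA.
  by rewrite mul_vec_lin BE mxvecK gi ip.
rewrite mxtrace_mulC.
have -> : lin_mx g *m B *m A = lin_mx g.
  apply/row_matrixP=> j; rewrite !rowE !mulmxA AE.
  by rewrite mul_rV_lin BE mxvecK passmx.rVofK // ipg.
rewrite /mxtrace (reindex _ (curry_mxvec_bij _ _)) /= pair_big /=.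
apply: eq_bigr => -[j k] _ /=; rewrite mxE /= mxvecE.
by rewrite vec_mx_delta.
Qed.

End MatrixTrace.

Section SpecialLinear.
Variables (F : fieldType) (n : nat).
Local Notation slF := (sl F n.+1).
Implicit Types (A B : 'M[F]_n.+1) (x y : slF).

Lemma vsproj_slK A : \tr A = 0 -> vsval (vsproj (sl_vs F n.+1) A) = A.
Proof. by move=> trA; rewrite vsprojK // mem_sl trA. Qed.

Lemma mxtrace_sl x : \tr (vsval x) = 0.
Proof. by apply/eqP; rewrite -mem_sl subvsP. Qed.

Lemma vsval_lie x y : vsval (lie x y) = mxbracket (vsval x) (vsval y).
Proof. exact: sl_lieE. Qed.

Lemma vsval_iter_lie k x y :
  vsval (iter k (lie x) y) = iter k (mxbracket (vsval x)) (vsval y).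
Proof. by elim: k => //= k <-; rewrite vsval_lie. Qed.

Lemma mxtrace_mxbracket A B : \tr (mxbracket A B) = 0.
Proof. by rewrite linearB /= mxtrace_mulC subrr. Qed.

Lemma vsproj_lie A B : \tr A = 0 -> \tr B = 0 ->
  vsproj (sl_vs F n.+1) (mxbracket A B)
    = lie (vsproj _ A : slF) (vsproj _ B : slF).
Proof.
move=> trA trB; apply: val_inj; rewrite /= vsval_lie !vsproj_slK //.
exact: mxtrace_mxbracket.
Qed.

Definition sl_val x := vsval x.
Definition sl_proj A : slF := vsproj (sl_vs F n.+1) A.

Lemma sl_val_linear : linear sl_val. Proof. exact: sl_valP. Qed.
Lemma sl_proj_linear : linear sl_proj. Proof. exact: linearP. Qed.

HB.instance Definition _ :=
  GRing.isLinear.Build F slF 'M[F]_n.+1 _ sl_val sl_val_linear.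
HB.instance Definition _ :=
  GRing.isLinear.Build F 'M[F]_n.+1 slF _ sl_proj sl_proj_linear.

Lemma lfun_trace_sl (f : 'End(slF)) (g : {linear 'M[F]_n.+1 -> 'M[F]_n.+1}) :
  (forall x, g (vsval x) = vsval (f x)) -> (forall A, \tr (g A) = 0) ->
  lfun_trace f = \sum_i \sum_j g (delta_mx i j) i j.
Proof.
move=> fg trg.
apply: (@mxtrace_mxof_retract F slF n.+1 _ f sl_val sl_proj g) => [|x||A].
- exact: vbasisP.
- exact: vsvalK.
- exact: fg.
- exact: vsproj_slK.
Qed.

Lemma mxbracket_linear A : linear (mxbracket A).
Proof.
move=> a X Y; rewrite /mxbracket mulmxDr mulmxDl -scalemxAl -scalemxAr.
by rewrite scalerBr opprD addrACA.
Qed.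

HB.instance Definition _ A := GRing.isLinear.Build F 'M[F]_n.+1 'M[F]_n.+1 _
  (mxbracket A) (mxbracket_linear A).

Lemma mul_delta_mx_entry A B i j : (A *m delta_mx i j *m B) i j = A i i * B j j.
Proof.
rewrite -(mul_delta_mx (0 : 'I_1)) mulmxA -colE -mulmxA -rowE mxE big_ord1.
by rewrite !mxE.
Qed.

(** Brackets are traceless, so the trace of ad X ad Y may be taken over all matrices. The diagonal
    coefficient at E_ij is (XY)_ii - X_ii Y_jj - Y_ii X_jj + (YX)_jj, and the mixed terms sum to
    products of zero traces. *)
Lemma killing_sl x y :
  killing x y = (2 * n.+1)%:R * \tr (vsval x *m vsval y).
Proof.
rewrite /killing.
set X := vsval x; set Y := vsval y.
pose g : {linear 'M[F]_n.+1 -> 'M[F]_n.+1} := mxbracket X \o mxbracket Y.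
rewrite (@lfun_trace_sl _ g) => [|z|A]; last exact: mxtrace_mxbracket.
  have gE i j : g (delta_mx i j) i j
      = (X *m Y) i i - X i i * Y j j - (Y i i * X j j - (Y *m X) j j).
    rewrite /g /= /mxbracket mulmxBr mulmxBl !mulmxA.
    have subE (M N P Q : 'M[F]_n.+1) :
        (M - N - (P - Q)) i j = M i j - N i j - (P i j - Q i j).
      by rewrite !mxE.
    have oneE k : (1%:M : 'M[F]_n.+1) k k = 1 by rewrite mxE eqxx.
    have El : (X *m Y *m delta_mx i j) i j = (X *m Y) i i.
      by have := mul_delta_mx_entry (X *m Y) 1%:M i j; rewrite mulmx1 oneE mulr1.
    have Er : (delta_mx i j *m Y *m X) i j = (Y *m X) j j.
      have := mul_delta_mx_entry 1%:M (Y *m X) i j.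
      by rewrite mul1mx mulmxA oneE mul1r.
    by rewrite subE El Er !mul_delta_mx_entry.
  under eq_bigr => i _ do under eq_bigr => j _ do rewrite gE.
  have sum2l (h : 'I_n.+1 -> F) :
      \sum_(i < n.+1) \sum_(j < n.+1) h i = n.+1%:R * \sum_i h i.
    rewrite mulr_sumr; apply: eq_bigr => i _.
    by rewrite sumr_const card_ord mulr_natl.
  have sum2r (h : 'I_n.+1 -> F) :
      \sum_(i < n.+1) \sum_(j < n.+1) h j = n.+1%:R * \sum_i h i.
    by rewrite exchange_big sum2l.
  have sum2 (h k : 'I_n.+1 -> F) :
      \sum_(i < n.+1) \sum_(j < n.+1) h i * k j = (\sum_i h i) * \sum_j k j.
    by rewrite mulr_suml; apply: eq_bigr => i _; rewrite mulr_sumr.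
  under eq_bigr => i _ do rewrite !sumrB.
  rewrite !sumrB sum2l sum2r !sum2 -!/(\tr _) !mxtrace_sl !mul0r subr0 sub0r.
  by rewrite opprK (mxtrace_mulC Y) -mulrDl -natrD addnn mul2n.
by rewrite comp_lfunE !lfunE /= !vsval_lie.
Qed.

End SpecialLinear.

(** * The diagram automorphism *)

Section DiagramAutomorphism.
Variables (F : fieldType) (n : nat).
Hypothesis even_n : ~~ odd n.
Local Notation slF := (sl F n.+1).
Implicit Types (A B : 'M[F]_n.+1) (x y : slF).

Definition flip_form : 'M[F]_n.+1 :=
  \matrix_(i, j) ((-1) ^+ i *+ (j == rev_ord i)).

Local Notation J := flip_form.

Definition flip A := - (J *m A^T *m J).

(** Since n is even, n - i has the parity of i; this is what makes J symmetric with J J = 1. *)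
Lemma sign_rev_ord (i : 'I_n.+1) : (-1) ^+ rev_ord i = (-1) ^+ i :> F.
Proof.
rewrite -signr_odd -[RHS]signr_odd /= subSS oddB -1?ltnS //.
by rewrite (negPf even_n).
Qed.

Lemma flip_form_sym : J^T = J.
Proof.
apply/matrixP=> i j; rewrite !mxE -(inj_eq rev_ord_inj) rev_ordK eq_sym.
by have [->|] := eqVneq j (rev_ord i); rewrite ?sign_rev_ord.
Qed.

Lemma flip_form_entry A i j :
  (J *m A) i j = (-1) ^+ i * A (rev_ord i) j.
Proof.
rewrite mxE (bigD1 (rev_ord i)) //= big1 ?addr0 => [|k /negPf ki].
  by rewrite mxE eqxx.
by rewrite mxE ki mul0r.
Qed.

Lemma flip_formK : J *m J = 1%:M.
Proof.
apply/matrixP=> i j; rewrite flip_form_entry !mxE rev_ordK sign_rev_ord.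
by rewrite mulrnAr -expr2 sqrr_sign eq_sym.
Qed.

Lemma flip_form_unit : J \in unitmx.
Proof. by have [] := mulmx1_unit flip_formK. Qed.

Lemma flip_delta_mx i j :
  flip (delta_mx i j) = - (-1) ^+ (i + j) *: delta_mx (rev_ord j) (rev_ord i).
Proof.
apply/matrixP=> p q; rewrite /flip trmx_delta mxE.
rewrite -[J in _ *m J]flip_form_sym -[J *m delta_mx _ _]trmxK -trmx_mul mxE.
rewrite flip_form_entry mxE flip_form_entry !mxE.
rewrite -(inj_eq rev_ord_inj) rev_ordK -[rev_ord q == i](inj_eq rev_ord_inj) rev_ordK.
have [->|_] := eqVneq p; have [->|_] := eqVneq q; rewrite ?mulr0 ?oppr0 //=.
by rewrite !sign_rev_ord exprD; ring.
Qed.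

Lemma flip_mxbracket A B : flip (mxbracket A B) = mxbracket (flip A) (flip B).
Proof.
have flipM X Y : flip X *m flip Y = J *m (Y *m X)^T *m J.
  rewrite /flip mulNmx mulmxN opprK trmx_mul !mulmxA.
  by rewrite -(mulmxA _ J J) flip_formK mulmx1.
rewrite /mxbracket !flipM -mulmxBl -mulmxBr -linearB /= -(opprB (A *m B)).
by rewrite linearN /= mulmxN mulNmx.
Qed.

Lemma flip_linear : linear flip.
Proof.
move=> a A B; rewrite /flip linearP /= mulmxDr mulmxDl opprD.
by rewrite -scalemxAr -scalemxAl scalerN.
Qed.

HB.instance Definition _ := GRing.isLinear.Build F 'M[F]_n.+1 'M[F]_n.+1 _
  flip flip_linear.

(** The case e = 1 is the orthogonal Lie algebra; e = -1 gives the matrices self-adjoint for the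
    form. *)
Lemma flip_eqP A (e : F) : e * e = 1 ->
  flip A = e *: A <-> A *m J = - e *: (J *m A^T).
Proof.
move=> e1; rewrite /flip; split=> [fA|AJ].
  have EA : A = - e *: (J *m A^T *m J).
    by rewrite scaleNr -scalerN fA scalerA e1 scale1r.
  by rewrite {1}EA -scalemxAl -mulmxA flip_formK mulmx1.
have -> : J *m A^T = - e *: (A *m J).
  by rewrite AJ scalerA mulrNN e1 scale1r.
by rewrite -scalemxAl -mulmxA flip_formK mulmx1 scaleNr opprK.
Qed.

Lemma mxtrace_so_flip A : 2 != 0 :> F -> A *m J = - (J *m A^T) -> \tr A = 0.
Proof.
move=> char2 AJ; have AE : A = - (J *m A^T *m J).
  by rewrite -mulNmx -AJ -mulmxA flip_formK mulmx1.
have /eqP : \tr A = - \tr A.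
  rewrite {1}AE linearN /= mxtrace_mulC mulmxA flip_formK mul1mx.
  by rewrite mxtrace_tr.
by rewrite -subr_eq0 opprK -mulr2n -mulr_natl mulf_eq0 (negPf char2) => /eqP.
Qed.

Variable s : 'End(slF).
Hypothesis s_diagram : diagram_automorphism s.

Let Q A := \tr A = 0 /\ vsval (s (vsproj (sl_vs F n.+1) A)) = flip A.

Let Q_lin a A B : Q A -> Q B -> Q (a *: A + B).
Proof.
move=> [trA QA] [trB QB]; split; first by rewrite mxtraceD mxtraceZ trA trB mulr0 addr0.
by rewrite !linearP /= QA QB.
Qed.

Let Q_mxbracket A B : Q A -> Q B -> Q (mxbracket A B).
Proof.
move=> [trA QA] [trB QB]; split; first exact: mxtrace_mxbracket.
have [[_ s_lie] _ _] := s_diagram.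
by rewrite vsproj_lie // s_lie vsval_lie QA QB flip_mxbracket.
Qed.

Let mxtrace_delta (i j : 'I_n.+1) : i != j -> \tr (delta_mx i j : 'M[F]_n.+1) = 0.
Proof.
move=> ij; apply: big1 => k _; rewrite mxE.
by have [->|//] := eqVneq k i; rewrite (negPf ij).
Qed.

Let mxbracket_delta (i j k : 'I_n.+1) : i != k ->
  mxbracket (delta_mx i j) (delta_mx j k) = delta_mx i k :> 'M[F]_n.+1.
Proof.
by move=> ik; rewrite /mxbracket mul_delta_mx mul_delta_mx_0 ?subr0 1?eq_sym.
Qed.

(** The alternating signs in J are chosen for this: the coefficient - (-1)^(i + (i + 1)) is 1. *)
Let Q_e (i : 'I_n) : Q (delta_mx (widen_ord (leqnSn n) i) (lift ord0 i)).
Proof.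
have neq : widen_ord (leqnSn n) i != lift ord0 i.
  by rewrite -val_eqE /= /bump leq0n neq_ltn ltnSn.
split; first exact: mxtrace_delta.
have [_ -> _] := s_diagram; rewrite /chevalley_e vsproj_slK; last first.
  by rewrite mxtrace_delta // -val_eqE /= /bump leq0n neq_ltn ltnSn.
rewrite flip_delta_mx /= /bump leq0n add1n addnS exprS addnn -signr_odd.
rewrite odd_double mulN1r opprK scale1r; congr delta_mx; apply: val_inj => /=.
by rewrite /bump leq0n add1n subSS subnSK.
Qed.

Let Q_f (i : 'I_n) : Q (delta_mx (lift ord0 i) (widen_ord (leqnSn n) i)).
Proof.
have neq : lift ord0 i != widen_ord (leqnSn n) i.
  by rewrite -val_eqE /= /bump leq0n neq_ltn ltnSn orbT.
split; first exact: mxtrace_delta.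
have [_ _ ->] := s_diagram; rewrite /chevalley_f vsproj_slK; last first.
  by rewrite mxtrace_delta // -val_eqE /= /bump leq0n neq_ltn ltnSn orbT.
rewrite flip_delta_mx /= /bump leq0n add1n addSn exprS addnn -signr_odd.
rewrite odd_double mulN1r opprK scale1r; congr delta_mx; apply: val_inj => /=.
  by rewrite /bump leq0n add1n subSS subnSK.
by rewrite /bump leq0n add1n subSS.
Qed.

(** Induction on the distance from the diagonal: E_pq = [E_pr, E_rq] and E_qp = [E_qr, E_rp] with r
    = q - 1. *)
Let Q_delta (i j : 'I_n.+1) : i != j -> Q (delta_mx i j).
Proof.
have gen k (p q : 'I_n.+1) : (q = p + k.+1 :> nat)%N ->
    Q (delta_mx p q) /\ Q (delta_mx q p).
  elim: k q => [|k IHk] q qE.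
    have pn : (p < n)%N by have := ltn_ord q; rewrite qE addn1 ltnS.
    have := (Q_e (Ordinal pn), Q_f (Ordinal pn)).
    have -> : widen_ord (leqnSn n) (Ordinal pn) = p by apply: val_inj.
    suff -> : lift ord0 (Ordinal pn) = q by case.
    by apply: val_inj; rewrite /= /bump leq0n qE addn1.
  have rn : (p + k.+1 < n)%N by have := ltn_ord q; rewrite qE addnS ltnS.
  pose r' := Ordinal rn; pose r := widen_ord (leqnSn n) r'.
  have qr : q = lift ord0 r'.
    by apply: val_inj; rewrite /= /bump leq0n qE addnS.
  have [Qpr Qrp] := IHk r erefl; have npq : p != q.
    by rewrite -val_eqE /= qE neq_ltn -addn1 leq_add.
  rewrite -(mxbracket_delta r npq) -(@mxbracket_delta q r p) 1?eq_sym // qr.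
  split; apply: Q_mxbracket => //; exact: (Q_e r').
rewrite -val_eqE neq_ltn => /orP[] /subnKC ij.
  by have [] := gen (j - i.+1)%N i j; rewrite // addnS -addSn ij.
by have [] := gen (i - j.+1)%N j i; rewrite // addnS -addSn ij.
Qed.

(* The automorphism agrees with flip on the Chevalley generators; the matrices
   B - (tr B) E_00 span the traceless ones. *)
Lemma diagram_automorphismE x : vsval (s x) = flip (vsval x).
Proof.
pose Q' B := Q (B - \tr B *: delta_mx 0 0).
have Q'D A B : Q' A -> Q' B -> Q' (A + B).
  move=> QA QB; rewrite /Q' mxtraceD scalerDl opprD addrACA.
  by rewrite -[A - _]scale1r; apply: Q_lin.
have Q0 : Q 0.
  by split; rewrite ?mxtrace0 // !linear0.
have Q'Z a A : Q' A -> Q' (a *: A).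
  move=> QA; rewrite /Q' mxtraceZ -scalerA -scalerBr -[_ *: _]addr0.
  exact: Q_lin.
have Q'delta i j : Q' (delta_mx i j).
  have [->|ij] := eqVneq i j; last first.
    by rewrite /Q' mxtrace_delta // scale0r subr0; apply: Q_delta.
  have tr1 (k : 'I_n.+1) : \tr (delta_mx k k : 'M[F]_n.+1) = 1.
    rewrite /mxtrace (bigD1 k) //= big1 ?addr0 => [|m /negPf mk].
      by rewrite mxE !eqxx.
    by rewrite mxE mk.
  rewrite /Q' tr1 scale1r; have [->|j0] := eqVneq j 0; first by rewrite subrr.
  (* E_jj - E_00 = [E_j0, E_0j]. *)
  have := Q_mxbracket (Q_delta j0) (Q_delta (_ : 0 != j)).
  by rewrite /mxbracket !mul_delta_mx eq_sym; apply.
have Q'x B : Q' B.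
  rewrite [B]matrix_sum_delta; elim/big_ind: _ => // [|i _].
    by rewrite /Q' mxtrace0 scale0r subr0.
  elim/big_ind: _ => // [|j _]; first by rewrite /Q' mxtrace0 scale0r subr0.
  exact: Q'Z.
have := Q'x (vsval x); rewrite /Q' mxtrace_sl scale0r subr0 => -[_].
by rewrite vsvalK.
Qed.

End DiagramAutomorphism.

(** * Cartan subalgebras of the fixed subalgebra *)

Section FixedSubalgebra.
Variables (C : numClosedFieldType) (n : nat).
Hypothesis even_n : ~~ odd n.
Local Notation slC := (sl C n.+1).
Local Notation J := (flip_form C n).
Variables (s : 'End(slC)) (G H : {vspace slC}).
Hypothesis s_diagram : diagram_automorphism s.
Hypothesis GE : forall x, (x \in G) = (s x == x).

Lemma fixed_so_form x : x \in G <-> so_form J (vsval x).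
Proof.
rewrite GE; have -> : (s x == x) = (flip (vsval x) == 1 *: vsval x).
  rewrite scale1r -(diagram_automorphismE even_n s_diagram).
  by apply/eqP/eqP => [->//|]; apply: sl_val_inj.
split=> [/eqP/(flip_eqP even_n _ (mulr1 1))|xso]; first by rewrite scaleN1r.
by apply/eqP/(flip_eqP even_n _ (mulr1 1)); rewrite scaleN1r.
Qed.

Lemma fixed_cartan_structure : cartan_subalgebra G H ->
  exists P, exists tau : 'I_n.+1 -> 'I_n.+1, exists i0, [/\ P \in unitmx,
    involutive tau,
    forall i, (tau i == i) = (i == i0),
    forall i j, ((P *m J *m P^T) i j != 0) = (j == tau i) &
    forall X, (exists2 x, x \in H & vsval x = X) <-> exists2 d : 'rV_n.+1,
      forall i, d 0 (tau i) = - d 0 i & P *m X *m invmx P = diag_mx d].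
Proof.
move=> hH; have [sHG subH nilH selfH] := hH.
have [k Hk] := lie_nilpotent_ad nilH.
apply: (orthogonal_cartan_structure (flip_form_sym C even_n)
  (flip_form_unit C even_n) _ _ _ even_n).
- by move=> _ [x xH <-]; apply/fixed_so_form/(subvP sHG).
- exists k => _ _ [x xH <-] [y yH <-].
  by rewrite -vsval_iter_lie Hk // linear0.
- move=> X soX Xnull.
  (* Orthogonal matrices of this form are traceless, so X lifts to sl, where Engel's argument places
     it in H. *)
  have trX : \tr X = 0.
    by apply: mxtrace_so_flip soX; rewrite ?pnatr_eq0.
  exists (vsproj (sl_vs _ _) X); last exact: vsproj_slK.
  apply: (cartan_subalgebra_ad_null hH) => [h g hh gG||h hh].
  + have [[_ s_lie] _ _] := s_diagram.
    have sh : s h = h by apply/eqP; rewrite -GE (subvP sHG).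
    by move: gG; rewrite !GE s_lie sh => /eqP ->.
  + by apply/fixed_so_form; rewrite vsproj_slK.
  + have [|k' hk'] := Xnull (vsval h); first by exists h.
    exists k'; apply: sl_val_inj.
    by rewrite vsval_iter_lie vsproj_slK // hk' linear0.
Qed.

End FixedSubalgebra.

(** * Weights of the twisted loop parts *)

(** For bare functions whose linearity is only a proposition, as in [killing_to_dual]; the linear
    structure is packed on the spot. *)
Lemma linfun_fun (F : fieldType) (aT rT : vectType F) (f : aT -> rT) :
  linear f -> linfun f =1 f.
Proof.
move=> lin x.
pose g : {linear aT -> rT} :=
  HB.pack f (GRing.isLinear.Build F aT rT *:%R f lin).
by rewrite -[linfun f]/(linfun g) lfunE.
Qed.

Lemma linfun_bilinear (F : fieldType) (U V W : vectType F) (B : U -> V -> W) :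
  (forall x, linear (B x)) -> (forall y, linear (B^~ y)) ->
  forall x y, linfun (fun z => linfun (B z)) x y = B x y.
Proof.
move=> lin2 lin1 x y; rewrite linfun_fun ?linfun_fun // => a u v.
apply/lfunP=> z; rewrite add_lfunE scale_lfunE !linfun_fun //.
exact: (lin1 z).
Qed.

Lemma scalemx_mid (F : comNzRingType) m n p q (A : 'M[F]_(m, n))
    (a : F) (B : 'M_(n, p)) (D : 'M_(p, q)) :
  A *m (a *: B) *m D = a *: (A *m B *m D).
Proof. by rewrite -scalemxAr -scalemxAl. Qed.

Section OrthogonalWeights.
Variables (R : realType) (n : nat).
Hypotheses (even_n : ~~ odd n) (n_gt0 : (0 < n)%N).
Local Notation C := R[i].
Local Notation slC := (sl C n.+1).
Local Notation J := (flip_form C n).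
Variables (s : 'End(slC)) (H : {vspace slC}).
Hypothesis s_diagram : diagram_automorphism s.
Hypothesis sH : forall h, h \in H -> s h = h.
Variables (P : 'M[C]_n.+1) (tau : 'I_n.+1 -> 'I_n.+1) (i0 : 'I_n.+1).
Hypotheses (Pu : P \in unitmx) (tauK : involutive tau)
  (tau_fix : forall i, (tau i == i) = (i == i0))
  (PJP : forall i j, ((P *m J *m P^T) i j != 0) = (j == tau i))
  (HE : forall X, (exists2 x, x \in H & vsval x = X) <->
    exists2 d : 'rV_n.+1, forall i, d 0 (tau i) = - d 0 i
                        & P *m X *m invmx P = diag_mx d).

Local Notation D := (P *m J *m P^T).

Definition conj_by_P (X : 'M[C]_n.+1) := P *m X *m invmx P.
Local Notation cj := conj_by_P.

Lemma cjK X : invmx P *m cj X *m P = X.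
Proof. by rewrite /cj !mulmxA mulVmx // mul1mx mulmxKV. Qed.

Lemma cjVK X : cj (invmx P *m X *m P) = X.
Proof. by rewrite /cj !mulmxA mulmxV // mul1mx mulmxK. Qed.

Lemma cjM X Y : cj (X *m Y) = cj X *m cj Y.
Proof. by rewrite /cj !mulmxA mulmxKV. Qed.

Lemma cj_linear a X Y : cj (a *: X + Y) = a *: cj X + cj Y.
Proof. by rewrite /cj mulmxDr mulmxDl -scalemxAr -scalemxAl. Qed.

Lemma cj0 : cj 0 = 0.
Proof. by rewrite /cj mulmx0 mul0mx. Qed.

Lemma cjZ a X : cj (a *: X) = a *: cj X.
Proof. by rewrite -[a *: X]addr0 cj_linear cj0 addr0. Qed.

Lemma cj_sl_inj (x y : slC) : cj (vsval x) = cj (vsval y) -> x = y.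
Proof.
by move=> xy; rewrite -[x]vsvalK -[vsval x]cjK xy cjK vsvalK.
Qed.

Lemma vsval_slZ a (x : slC) : vsval (a *: x) = a *: vsval x.
Proof. by rewrite linearZ. Qed.

Lemma mxtrace_cj X : \tr (cj X) = \tr X.
Proof. by rewrite mxtrace_mulC mulmxA mulVmx // mul1mx. Qed.

Definition weight_fun i (h : subvs_of H) : C^o := cj (vsval (vsval h)) i i.

Definition weight i : dual_space H := linfun (weight_fun i).

Lemma weightE i h : weight i h = cj (vsval (vsval h)) i i.
Proof.
have addE a (A B : 'M[C]_n.+1) : (a *: A + B) i i = a * A i i + B i i.
  by rewrite !mxE.
by rewrite /weight linfun_fun // => a x y; rewrite /weight_fun !linearP cj_linear addE.
Qed.

Lemma cj_cartan (h : subvs_of H) :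
  cj (vsval (vsval h)) = diag_mx (\row_i weight i h)
  /\ forall i, weight (tau i) h = - weight i h.
Proof.
have /HE[d dtau Ed] : exists2 x, x \in H & vsval x = vsval (vsval h).
  by exists (vsval h); rewrite ?subvsP.
have wE i : weight i h = d 0 i by rewrite weightE /cj Ed mxE eqxx.
split=> [|i]; last by rewrite !wE.
by rewrite /cj Ed; congr diag_mx; apply/rowP=> i; rewrite mxE wE.
Qed.

Lemma weight_tau i : weight (tau i) = - weight i.
Proof. by apply/lfunP=> h; rewrite opp_lfunE (cj_cartan h).2. Qed.

Lemma weight_fix : weight i0 = 0.
Proof.
have := weight_tau i0; have /eqP -> : tau i0 == i0 by rewrite tau_fix.
move/eqP; rewrite -subr_eq0 opprK -mulr2n -scaler_nat scaler_eq0 pnatr_eq0 /=.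
by move/eqP.
Qed.

(** In the eigenbasis this is E_kk - E_(tau k, tau k), which is 0 for k = i0. *)
Lemma coweight_exists k : exists h : subvs_of H,
  forall i, weight i h = (i == k)%:R - (i == tau k)%:R.
Proof.
pose d : 'rV[C]_n.+1 := \row_i ((i == k)%:R - (i == tau k)%:R).
have [|x xH Ex] := (HE (invmx P *m diag_mx d *m P)).2.
  exists d => [i|]; last exact: (cjVK (diag_mx d)).
  by rewrite !mxE opprB (inj_eq (inv_inj tauK)) (can2_eq tauK tauK).
exists (vsproj H x) => i; rewrite weightE vsprojK // Ex cjVK !mxE eqxx.
by rewrite mulr1n.
Qed.

Definition coweight k : subvs_of H := sval (cid (coweight_exists k)).

Lemma weight_coweight i k :
  weight i (coweight k) = (i == k)%:R - (i == tau k)%:R.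
Proof. exact: (svalP (cid (coweight_exists k))). Qed.

(** The factor 2N of the Killing form of sl_N, doubled because k and tau k contribute equally to the
    pairing with [coweight k]. *)
Definition killing_scale : C := (4 * n.+1)%:R.
Local Notation c4 := killing_scale.

Lemma killing_scale_gt0 : 0 < c4.
Proof. by rewrite ltr0n. Qed.

Lemma killing_cartan (h h' : subvs_of H) :
  killing (vsval h) (vsval h')
    = (2 * n.+1)%:R * \sum_i weight i h * weight i h'.
Proof.
rewrite killing_sl -mxtrace_cj cjM (cj_cartan h).1 (cj_cartan h').1.
rewrite mulmx_diag mxtrace_diag; congr (_ * _).
by apply: eq_bigr => i _; rewrite !mxE.
Qed.

Lemma killing_coweight k (h : subvs_of H) :
  killing (vsval h) (vsval (coweight k)) = c4 * weight k h.
Proof.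
rewrite killing_cartan (eq_bigr (fun i => weight i h *+ (i == k)
    - weight i h *+ (i == tau k))); last first.
  by move=> i _; rewrite weight_coweight mulrBr !mulr_natr.
have pick (f : 'I_n.+1 -> C) j : \sum_i f i *+ (i == j) = f j.
  by rewrite (bigD1 j) //= eqxx big1 ?addr0 // => i /negPf->.
rewrite sumrB !pick weight_tau opp_lfunE opprK.
by rewrite /c4 -mulr2n -[_ *+ 2]mulr_natl mulrA -natrM mulnAC.
Qed.

Lemma killing_cartan_sym (h h' : subvs_of H) :
  killing (vsval h) (vsval h') = killing (vsval h') (vsval h).
Proof. by rewrite !killing_sl mxtrace_mulC. Qed.

Lemma killing_to_dualE (h h' : subvs_of H) :
  killing_to_dual H h h' = killing (vsval h) (vsval h').
Proof.
have lin2 (k : subvs_of H) : linear (fun h' : subvs_of H =>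
    killing (vsval k) (vsval h') : C^o).
  move=> a x y; rewrite linearP /= !killing_sl sl_valP mulmxDr -scalemxAr.
  by rewrite mxtraceD mxtraceZ mulrDr mulrCA.
apply: (linfun_bilinear lin2) => k a x y.
rewrite linearP /= !killing_sl sl_valP mulmxDl -scalemxAl.
by rewrite mxtraceD mxtraceZ mulrDr mulrCA.
Qed.

(** Pairing with the coweights recovers every diagonal entry. This nondegeneracy gives [dual_form]
    its meaning. *)
Lemma killing_to_dual_inj : lker (killing_to_dual H) == 0%VS.
Proof.
apply/lker0P=> x y xy; apply/val_inj/val_inj => /=.
suff wxy : \row_i weight i x = \row_i weight i y.
  by rewrite -[LHS]cjK -[RHS]cjK (cj_cartan x).1 (cj_cartan y).1 wxy.
apply/rowP=> k; rewrite !mxE.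
apply: (mulfI (lt0r_neq0 killing_scale_gt0)).
by rewrite -!killing_coweight -!killing_to_dualE xy.
Qed.

Lemma weight_killing k : weight k = c4^-1 *: killing_to_dual H (coweight k).
Proof.
apply/lfunP=> h; rewrite scale_lfunE killing_to_dualE killing_cartan_sym.
rewrite killing_coweight /GRing.scale /= mulKf //.
exact: lt0r_neq0 killing_scale_gt0.
Qed.

Lemma dual_form_weightB i j b :
  dual_form (weight i - weight j) b = c4^-1 * (b (coweight i) - b (coweight j)).
Proof.
have -> : weight i - weight j
    = killing_to_dual H (c4^-1 *: (coweight i - coweight j)).
  by rewrite linearZ linearB /= scalerBr -!weight_killing.
by rewrite /dual_form lker0_lfunK ?killing_to_dual_inj // linearZ linearB.
Qed.

Lemma dual_form0 b : dual_form (0 : dual_space H) b = 0.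
Proof. by rewrite /dual_form !linear0. Qed.

(** Up to the scale, 4 is the norm of the doubled weights 2 w_i, 1 that of the nonzero w_i, and 2
    that of the remaining differences. *)
Lemma norm_weightB i j : i != j ->
  dual_form (weight i - weight j) (weight i - weight j)
    = c4^-1 * (if j == tau i then 4
               else if (i == i0) || (j == i0) then 1 else 2).
Proof.
move=> nij; rewrite dual_form_weightB; congr (_ * _).
have fixC k : (k == tau k) = (k == i0) by rewrite eq_sym tau_fix.
have ij : (i == tau j) = (j == tau i) by rewrite -(can2_eq tauK tauK) eq_sym.
rewrite !(add_lfunE, opp_lfunE) !weight_coweight !eqxx !fixC ij.
rewrite (eq_sym j i) (negPf nij).
have [jE|_] := eqVneq j (tau i).
  have ni : (i == i0) = false.
    by apply: contraNF nij => ii0; rewrite jE eq_sym tau_fix.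
  have nj : (j == i0) = false.
    by rewrite -tau_fix {1}jE tauK (negPf nij).
  by rewrite ni nj /= !mulr0n mulr1n; ring.
have : ~~ ((i == i0) && (j == i0)).
  by apply: contra nij => /andP[/eqP-> /eqP->].
by case: (i == i0); case: (j == i0) => //= _; rewrite ?mulr0n ?mulr1n; ring.
Qed.

Lemma dual_form_neq0 (a : dual_space H) : dual_form a a != 0 -> a != 0.
Proof. by apply: contraNneq => ->; rewrite dual_form0. Qed.

Lemma norm_weightB_neq0 i j : i != j ->
  dual_form (weight i - weight j) (weight i - weight j) != 0.
Proof.
move=> nij; rewrite norm_weightB // mulf_neq0 //.
  by rewrite invr_neq0 // lt0r_neq0 // killing_scale_gt0.
by case: ifP => _; last case: ifP => _; rewrite ?oner_neq0 ?pnatr_eq0.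
Qed.

Definition weight_vector (e : C) (a : dual_space H) :=
  exists x : slC, [/\ x != 0, s x = e *: x &
    forall h : subvs_of H, lie (vsval h) x = (a h : C) *: x].

Lemma cj_lie (h : subvs_of H) x i j :
  cj (vsval (lie (vsval h) x)) i j = (weight i h - weight j h) * cj (vsval x) i j.
Proof.
have cjB X Y : cj (X - Y) = cj X - cj Y.
  by rewrite /cj mulmxBr mulmxBl.
rewrite vsval_lie /mxbracket cjB !cjM (cj_cartan h).1.
rewrite mul_diag_mx mul_mx_diag; move: (cj _) => Y.
by rewrite !mxE mulrBl [Y i j * _]mulrC.
Qed.

Lemma mul_gram_entry (i j : 'I_n.+1) (Y : 'M[C]_n.+1) :
  ((Y *m D) i (tau j) = Y i j * D j (tau j))
  * ((D *m Y) i j = D i (tau i) * Y (tau i) j).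
Proof.
have D0 k m : m != tau k -> D k m = 0.
  by move=> km; apply/eqP; apply: contraNT km; rewrite PJP.
move: (D) D0 => D' D0; split; rewrite mxE.
  rewrite (bigD1 j) //= big1 ?addr0 // => k kj.
  by rewrite D0 ?mulr0 // (inj_eq (inv_inj tauK)) eq_sym.
by rewrite (bigD1 (tau i)) //= big1 ?addr0 // => k kj; rewrite D0 ?mul0r.
Qed.

Lemma gram_neq0 i : D i (tau i) != 0.
Proof. by rewrite PJP. Qed.

Lemma gram_sym i j : D i j = D j i.
Proof.
have -> : D j i = D^T i j by rewrite [RHS]mxE.
by rewrite !trmx_mul trmxK flip_form_sym // mulmxA.
Qed.

Lemma cj_skew (X : 'M[C]_n.+1) (e : C) : X *m J = - e *: (J *m X^T) ->
  cj X *m D = - e *: (D *m (cj X)^T).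
Proof.
move=> XJ.
have -> : cj X *m D = P *m (X *m J) *m P^T by rewrite /cj !mulmxA mulmxKV.
have -> : D *m (cj X)^T = P *m (J *m X^T) *m P^T.
  have PTu : P^T \in unitmx by rewrite unitmx_tr.
  by rewrite /cj !trmx_mul trmx_inv !mulmxA mulmxK.
by rewrite XJ; apply: scalemx_mid.
Qed.

(** The Gram matrix D is supported on the pairs (k, tau k), so the eigenvalue equation ties the
    entry (i, j) to the entry (tau j, tau i) only. *)
Lemma eigenvector_cj (x : slC) (e : C) : e * e = 1 -> s x = e *: x ->
  forall i j, cj (vsval x) i j * D j (tau j)
    = - e * (D i (tau i) * cj (vsval x) (tau j) (tau i)).
Proof.
move=> e1 sx i j.
have : flip (vsval x) = e *: vsval x.
  by rewrite -(diagram_automorphismE even_n s_diagram) sx linearZ.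
move/(flip_eqP even_n _ e1)/cj_skew => YD.
have /matrixP/(_ i (tau j)) := YD.
have scE (A : 'M[C]_n.+1) k m : (- e *: A) k m = - e * A k m by rewrite mxE.
by rewrite scE !mul_gram_entry [(cj _)^T _ _]mxE.
Qed.

(** Any nonzero entry (i, j) of x in the eigenbasis reveals the weight. For e = 1 an entry (i, tau
    i) equals its own negative, hence vanishes. *)
Lemma weight_vector_sub e a : e * e = 1 -> a != 0 -> weight_vector e a ->
  exists i j, [/\ i != j, e = 1 -> j != tau i & a = weight i - weight j].
Proof.
move=> e1 a0 [x [x0 sx hx]].
have [i [j Yij]] : exists i j, cj (vsval x) i j != 0.
  apply: contrapT => /forallNP Y0; case/negP: x0; apply/eqP/cj_sl_inj.
  apply/matrixP=> i j; rewrite linear0 cj0 [RHS]mxE.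
  have /forallNP/(_ j)/negP := Y0 i.
  by rewrite negbK => /eqP.
have aE : a = weight i - weight j.
  apply/lfunP=> h; rewrite add_lfunE opp_lfunE; apply: (mulIf Yij).
  by rewrite -cj_lie hx vsval_slZ cjZ [RHS]mxE.
exists i, j; split=> //; first by apply: contraNneq a0 => ij; rewrite aE ij subrr.
move=> e1'; apply: contraNneq Yij => jE.
have := eigenvector_cj e1 sx i j; rewrite jE tauK (gram_sym (tau i)) e1' mulN1r mulrC.
move/eqP; rewrite -subr_eq0 opprK -mulr2n -mulrnAr mulf_eq0 (negPf (gram_neq0 i)).
by rewrite mulrn_eq0 /=.
Qed.

(** The witness is x0 + e s(x0) with x0 the matrix unit E_ij of the eigenbasis. If it were 0, x0
    would be an eigenvector for - e; this forces j = tau i, hence e = -1, and then symmetry of D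
    gives a contradiction. *)
Lemma weight_vector_exists e i j : e * e = 1 -> i != j ->
  (e = 1 -> j != tau i) -> e = 1 \/ e = -1 -> weight_vector e (weight i - weight j).
Proof.
move=> e1 nij ej e11; pose X := invmx P *m delta_mx i j *m P.
have trX : \tr X = 0.
  rewrite -mxtrace_cj cjVK; apply: big1 => k _; rewrite mxE.
  by have [->|//] := eqVneq k i; rewrite (negPf nij).
pose x0 : slC := vsproj (sl_vs C n.+1) X.
have x0E : cj (vsval x0) = delta_mx i j by rewrite vsproj_slK // cjVK.
have hx0 (h : subvs_of H) : lie (vsval h) x0 = (weight i - weight j) h *: x0.
  apply: cj_sl_inj; apply/matrixP=> p q; rewrite cj_lie vsval_slZ cjZ x0E.
  rewrite [RHS]mxE add_lfunE opp_lfunE mxE.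
  by have [->|_] := eqVneq p i; have [->|_] := eqVneq q j; rewrite ?mulr0.
have sK y : s (s y) = y.
  apply: val_inj; rewrite /= !(diagram_automorphismE even_n s_diagram) /flip.
  rewrite linearN /= mulmxN mulNmx opprK !trmx_mul trmxK flip_form_sym //.
  by rewrite !mulmxA flip_formK // mul1mx -mulmxA flip_formK // mulmx1.
have [[_ s_lie] _ _] := s_diagram.
exists (x0 + e *: s x0); split; last 2 first.
- by rewrite linearD linearZ /= sK scalerDr scalerA e1 scale1r addrC.
- move=> h; rewrite linearD linearZ /= -{2}[vsval h]sH ?subvsP // -s_lie hx0.
  by rewrite linearZ /= scalerDr !scalerA mulrC.
apply/eqP=> x00.
have sx0 : s x0 = - e *: x0.
  move/eqP: x00; rewrite addrC addr_eq0 => /eqP ex0.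
  by rewrite scaleNr -scalerN -ex0 scalerA e1 scale1r.
have /eigenvector_cj : (- e) * (- e) = 1 by rewrite mulrNN.
have dE p q : (delta_mx i j : 'M[C]_n.+1) p q = ((p == i) && (q == j))%:R.
  by rewrite mxE.
move=> /(_ _ sx0 i j); rewrite x0E !dE !eqxx mul1r opprK.
have [jE|njE] := eqVneq j (tau i); last first.
  rewrite andbF !mulr0 => /eqP.
  by rewrite (negPf (gram_neq0 j)).
rewrite jE tauK !eqxx (gram_sym (tau i)) mulr1.
have -> : e = -1 by case: e11 => // /ej /eqP.
rewrite mulN1r => /eqP; rewrite -subr_eq0 opprK -mulr2n mulrn_eq0.
by rewrite (negPf (gram_neq0 i)).
Qed.

Variable G : {vspace slC}.
Hypothesis GE : forall x, (x \in G) = (s x == x).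

Lemma lie_rootsP a : lie_roots G H a <->
  exists i j, [/\ i != j, j != tau i & a = weight i - weight j].
Proof.
have e1 : 1 * 1 = 1 :> C by rewrite mulr1.
split=> [[a0 [x [xG x0 hx]]]|[i [j [nij jti aE]]]].
  have [|i [j [nij jti aE]]] := weight_vector_sub e1 a0.
    by exists x; split=> //; rewrite scale1r; apply/eqP; rewrite -GE.
  by exists i, j; split=> //; apply: jti.
split; first by rewrite aE; apply: dual_form_neq0; apply: norm_weightB_neq0.
have [|x [x0 sx hx]] := weight_vector_exists e1 nij (fun _ => jti).
  by left.
by exists x; split; rewrite ?GE ?sx ?scale1r // aE.
Qed.

(** The least norm among the roots is that of w_i = w_i - w_i0; a root w_i0 - w_j of this norm is
    w_(tau j). *)
Lemma short_rootsP a : short_roots G H a <-> exists2 i, i != i0 & a = weight i.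
Proof.
have tau0 : tau i0 = i0 by apply/eqP; rewrite tau_fix.
have i0tau k : k != i0 -> i0 != tau k.
  by apply: contra => /eqP i0E; rewrite -(inj_eq (inv_inj tauK)) tau0 -i0E.
have norm1 k : k != i0 -> dual_form (weight k) (weight k) = c4^-1.
  move=> k0; have := norm_weightB k0; rewrite weight_fix subr0 => ->.
  by rewrite (negPf (i0tau k k0)) (negPf k0) eqxx mulr1.
have c4V : 0 < c4^-1 by rewrite invr_gt0 killing_scale_gt0.
split=> [[/lie_rootsP[i [j [nij jti ->]]] amin]|[i ni0 ->]].
  (* Positivity of n supplies an index other than i0, so that the minimal norm is attained. *)
  have k0 : lift i0 (Ordinal n_gt0) != i0 by rewrite eq_sym neq_lift.
  have /amin : lie_roots G H (weight (lift i0 (Ordinal n_gt0))).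
    apply/lie_rootsP; exists (lift i0 (Ordinal n_gt0)), i0.
    by rewrite weight_fix subr0 i0tau.
  rewrite norm1 // norm_weightB // (negPf jti) -[leRHS]mulr1 ler_pM2l //.
  case: ifP => [/orP[]/eqP i0E _|_]; last by rewrite (ler_nat _ 2 1).
    exists (tau j); last by rewrite i0E weight_fix sub0r weight_tau.
    by rewrite -tau0 (inj_eq (inv_inj tauK)) -i0E eq_sym.
  by exists i; rewrite -?i0E // i0E weight_fix subr0.
split=> [|b /lie_rootsP[k [m [nkm mtk ->]]]].
  by apply/lie_rootsP; exists i, i0; rewrite weight_fix subr0 i0tau.
rewrite norm1 // norm_weightB // (negPf mtk) -[leLHS]mulr1 ler_pM2l //.
by case: ifP => _; rewrite ?lexx ?(ler_nat _ 1 2).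
Qed.

Lemma double_weight i : weight i *+ 2 = weight i - weight (tau i).
Proof. by rewrite weight_tau opprK mulr2n. Qed.

(** For eigenvalue -1 the pairs (i, tau i) are allowed too; they contribute the weights 2 w_i. *)
Lemma odd_weightP a : a != 0 -> weight_vector (-1) a <->
  lie_roots G H a \/ exists2 b, short_roots G H b & a = b *+ 2.
Proof.
have e1 : -1 * -1 = 1 :> C by rewrite mulrNN mulr1.
have e1N : -1 <> 1 :> C.
  by move/eqP; rewrite eq_sym -subr_eq0 opprK -mulr2n pnatr_eq0.
move=> a0; split=> [/(weight_vector_sub e1 a0)[i [j [nij _ aE]]]|].
  have [jti|jti] := eqVneq j (tau i); last first.
    by left; apply/lie_rootsP; exists i, j.
  right; exists (weight i); last by rewrite double_weight -jti.
  by apply/short_rootsP; exists i; rewrite // -tau_fix -jti eq_sym.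
case=> [/lie_rootsP[i [j [nij _ ->]]]|[b /short_rootsP[i ni0 ->] ->]].
  by apply: weight_vector_exists => //; right.
rewrite double_weight; apply: weight_vector_exists => //; last by right.
by rewrite eq_sym tau_fix.
Qed.

Lemma root_norm_neq0 a : lie_roots G H a -> dual_form a a != 0.
Proof. by case/lie_rootsP=> i [j [nij _ ->]]; apply: norm_weightB_neq0. Qed.

Lemma double_short_norm_neq0 b : short_roots G H b ->
  dual_form (b *+ 2) (b *+ 2) != 0.
Proof.
case/short_rootsP=> i ni0 ->; rewrite double_weight.
by apply: norm_weightB_neq0; rewrite eq_sym tau_fix.
Qed.

End OrthogonalWeights.

(** * Weight spaces of the toroidal algebra *)

Section GradedParts.
Variable R : realType.

Lemma root_of_unity1 : Defs.root_of_unity R 1 = 1.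
Proof. by rewrite /Defs.root_of_unity divr1 mulr_natl cos2pi sin2pi. Qed.

Lemma root_of_unity2 : Defs.root_of_unity R 2 = -1.
Proof.
rewrite /Defs.root_of_unity mulrC mulKf ?pnatr_eq0 // cospi sinpi.
by apply/eqP; rewrite eq_complex /= oppr0 !eqxx.
Qed.

Lemma mem_leigenspace (F : fieldType) (V : vectType F) (f : 'End(V)) a x :
  (x \in passmx.leigenspace f a) = (f x == a *: x).
Proof. by rewrite memv_ker add_lfunE opp_lfunE scale_lfunE id_lfunE subr_eq0. Qed.

Lemma mem_graded_part (L : lieAlgType R[i]) (s : 'End(L)) p q x :
  (x \in graded_part s \1%VF 2 1 p q) = (s x == (-1) ^ p *: x).
Proof.
apply: etrans (memv_cap _ _ _) _.
apply: etrans (congr2 andb (mem_leigenspace s _ x) (mem_leigenspace _ _ x)) _.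
rewrite id_lfunE root_of_unity2 root_of_unity1.
by rewrite exp1rz scale1r eqxx andbT.
Qed.

Lemma exprN1_even (F : fieldType) (m : int) : (-1) ^ (2 * m) = 1 :> F.
Proof. by rewrite -exprz_exp -(exprnP (-1) 2) sqrrN expr1n exp1rz. Qed.

Lemma exprN1_odd (F : fieldType) (m : int) : (-1) ^ (2 * m + 1) = -1 :> F.
Proof. by rewrite expfzDr ?oppr_eq0 ?oner_eq0 // exprN1_even mul1r. Qed.

Lemma int_even_or_odd (p : int) : exists m : int, p = 2 * m \/ p = 2 * m + 1.
Proof.
exists (p %/ 2)%Z; have := divz_eq p 2.
have := modz_ge0 p (isT : 2 != 0 :> int).
have := @ltz_pmod p 2 isT; rewrite [2 * _]mulrC.
case: (p %% 2)%Z => // -[|[|//]] _ _ pE; [left|right] => //.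
by rewrite {1}pE addr0.
Qed.

End GradedParts.

Lemma scaler_mulrzD (F : fieldType) (V : lmodType F) (x : V) a b (p q : int) :
  a *: (x *~ p) + b *: (x *~ q) = (a * p%:~R + b * q%:~R) *: x.
Proof. by rewrite scalerDl -!scalerA !scaler_int. Qed.

Section ConstantLoops.
Variables (F : fieldType) (L : lieAlgType F).

Lemma kpi0 : kpi 0 = 0 :> kspace F.
Proof. by apply: (addrI (kpi 0)); rewrite -kpiD !addr0. Qed.

Lemma loop_lie_const (x : L) (f : loop L) r :
  (loop_lie << x *g (0, 0) >> f)@_r = lie x f@_r.
Proof.
rewrite /loop_lie; have [->|x0] := eqVneq x 0.
  by rewrite monalgU0 msupp0 big_nil mcoeff0 lie0l.
rewrite msuppU (negPf x0) big_seq_fset1 raddf_sum /= mcoeffUU.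
have add0 (r' : expo) : (0, 0) + r' = r' by rewrite -[(0, 0)]/(0 : expo) add0r.
under eq_bigr => r' _ do rewrite add0 mcoeffU.
have [rf|rf] := msuppP; last first.
  rewrite linear0 big1_fset // => k kf _; case: eqP => // kr.
  by rewrite -kr kf in rf.
rewrite (big_fsetD1 r) //= eqxx big1_fset ?addr0 // => k.
by rewrite in_fsetD1 => /andP[/negPf->].
Qed.

(** The cocycle involves the differential of the monomials of its first argument, here a
    constant. *)
Lemma loop_cocycle_const (x : L) (f : loop L) :
  loop_cocycle << x *g (0, 0) >> f = 0.
Proof.
rewrite /loop_cocycle; have [->|x0] := eqVneq x 0.
  by rewrite monalgU0 msupp0 big_nil.
rewrite msuppU (negPf x0) big_seq_fset1; apply: big1 => r _ /=.
by rewrite mulr0z monalgU0 -[(0, 0)]/(0 : omega1 F) kpi0.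
Qed.

Lemma loop_coefZ a (f : loop L) r : (a *: f)@_r = a *: f@_r.
Proof. exact: loop_scaleE. Qed.

Lemma loop_deriv_coef a (f : loop L) r :
  (loop_deriv a f)@_r = (a.1 * r.1%:~R + a.2 * r.2%:~R) *: f@_r.
Proof.
rewrite /loop_deriv mcoeffD !loop_coefZ !degree_opE.
exact: scaler_mulrzD.
Qed.

Lemma degree_op0 (V : zmodType) p : degree_op p (0 : {malg V[expo]}) = 0.
Proof. by apply/malgP=> r; rewrite degree_opE mcoeff0 mul0rz. Qed.

Lemma k_degree_op0 p : k_degree_op p (0 : kspace F) = 0.
Proof.
by rewrite -{1}kpi0 k_degree_opE /omega1_degree_op /= degree_op0 kpi0.
Qed.

Lemma k_deriv0 a : k_deriv a (0 : kspace F) = 0.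
Proof. by rewrite /k_deriv !k_degree_op0 !scaler0 addr0. Qed.

Lemma k_deriv_const a (c : F * F) :
  k_deriv a (kpi (<< c.1 *g (0, 0) >>, << c.2 *g (0, 0) >>)) = 0.
Proof.
suff E p : p (0, 0) = 0 -> k_degree_op p
    (kpi (<< c.1 *g (0, 0) >>, << c.2 *g (0, 0) >>)) = 0 :> kspace F.
  by rewrite /k_deriv !E // !scaler0 addr0.
move=> p0; rewrite k_degree_opE.
have dU (x : F) : degree_op p << x *g (0, 0) >> = 0.
  apply/malgP=> r; rewrite degree_opE mcoeffU mcoeff0.
  by case: eqP => [<-|_]; rewrite ?p0 ?mulr0z ?mul0rz.
have E2 : omega1_degree_op p (<< c.1 *g (0, 0) >>, << c.2 *g (0, 0) >>) = (0, 0).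
  exact: (congr2 pair (dU c.1) (dU c.2)).
rewrite E2.
exact: kpi0.
Qed.

Lemma loop_deriv_const a (x : L) : loop_deriv a << x *g (0, 0) >> = 0.
Proof.
apply/malgP=> r; rewrite loop_deriv_coef mcoeffU mcoeff0.
by case: eqP => [<-|_]; rewrite ?mulr0 ?addr0 ?scale0r ?scaler0.
Qed.

End ConstantLoops.

Lemma scaler_injl (F : fieldType) (V : lmodType F) (v : V) :
  v != 0 -> injective (fun a : F => a *: v).
Proof.
move=> v0 a b /eqP; rewrite -subr_eq0 -scalerBl scaler_eq0 (negPf v0) orbF.
by rewrite subr_eq0 => /eqP.
Qed.

Section WeightSpaces.
Variables (R : realType) (L : lieAlgType R[i]) (s : 'End(L)) (H : {vspace L}).
Local Notation C := R[i].

Lemma pair_mulrz (V W : zmodType) (x : V) (y : W) (m : int) :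
  (x, y) *~ m = (x *~ m, y *~ m).
Proof.
have nat_case n : (x, y) *+ n = (x *+ n, y *+ n).
  by elim: n => [|n IHn]; rewrite ?mulr0n // !mulrS IHn.
by case: m => n; rewrite /intmul /= nat_case.
Qed.

Lemma root_extE (a : dual_space H) (m n : int) :
  root_ext a + delta0 H *~ m + delta1 H *~ n = (a, (m%:~R, n%:~R)).
Proof.
rewrite /root_ext /delta0 /delta1 !pair_mulrz !mul0rz.
apply: injective_projections => /=; first by rewrite !addr0.
by apply: injective_projections; rewrite /= ?addr0 ?add0r.
Qed.

(** The central and derivation parts of X have weight 0 on H, so they vanish. Any nonzero
    coefficient of the loop part is then a weight vector, and its exponents are the coefficients of
    delta_0 and delta_1. *)
Lemma weight_space_component (b : root_space H) X : b.1 != 0 ->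
  weight_space s \1%VF 2 1 b X -> X != 0 ->
  exists m n : int, exists x, [/\ b.2 = (m%:~R, n%:~R), x != 0,
    s x = (-1) ^ m *: x &
    forall h : subvs_of H, lie (vsval h) x = (b.1 h : C) *: x].
Proof.
case: X => [[f w] a] b0 [[/= fgr _] wX] X0.
have [h0 bh0] : exists h, b.1 h != 0.
  apply: contrapT => /forallNP bE; case/negP: b0; apply/eqP/lfunP=> h.
  by rewrite zero_lfunE; apply/eqP; have /negP := bE h; rewrite negbK.
(* Evaluation at h0, where b is nonzero, forces [a] and [w] to be 0. *)
have := wX (h0, (0, 0), (0, 0)); rewrite /= !mulr0 !addr0.
case=> [_ Ew Ea1 Ea2].
have a0 : a = 0.
  have scale0 (c : C^o) : 0 = b.1 h0 *: c -> c = 0.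
    by move/esym/eqP; rewrite scaler_eq0 (negPf bh0) => /eqP.
  by apply: injective_projections; [apply: scale0 Ea1|apply: scale0 Ea2].
have {Ew} w0 : w = 0.
  move: Ew; rewrite loop_cocycle_const add0r a0.
  have -> : k_deriv (0, 0) w = 0 by rewrite /k_deriv !scale0r addr0.
  rewrite (k_deriv_const _ (0, 0)) subrr => /esym/eqP.
  by rewrite scaler_eq0 (negPf bh0) => /eqP.
have [r fr] : exists r, f@_r != 0.
  apply: contrapT => /forallNP f0; case/negP: X0; apply/eqP.
  rewrite a0 w0 (_ : f = 0) //; apply/malgP=> r; rewrite mcoeff0.
  by apply/eqP; have /negP := f0 r; rewrite negbK.
have wr h a0' a1' : lie (vsval h) f@_r + (a0' * r.1%:~R + a1' * r.2%:~R) *: f@_r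
    = (b.1 h + b.2.1 * a0' + b.2.2 * a1') *: f@_r.
  have /(congr1 (fun X => X.1.1@_r)) := wX (h, (a0', a1'), (0, 0)).
  by rewrite /= a0 mcoeffB mcoeffD loop_lie_const loop_deriv_const mcoeff0
    subr0 loop_deriv_coef loop_coefZ.
exists r.1, r.2, f@_r; split=> //; last 2 first.
- by apply/eqP; rewrite -(mem_graded_part s r.1 r.2).
- by move=> h; have := wr h 0 0; rewrite !mul0r !mulr0 !addr0 scale0r addr0.
(* The actions of d_0 and d_1 alone read off the two exponents. *)
have := wr 0 1 0; have := wr 0 0 1.
rewrite !linear0 !lie0l !add0r !mul0r !mulr0 !mul1r !mulr1 !addr0 !add0r.
move=> /(scaler_injl fr) E2 /(scaler_injl fr) E1.
by rewrite E1 E2 -surjective_pairing.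
Qed.

(** The witness is the single term x t_0^m t_1^n. *)
Lemma weight_space_of_component (a : dual_space H) (m n : int) x : x != 0 ->
  s x = (-1) ^ m *: x ->
  (forall h : subvs_of H, lie (vsval h) x = (a h : C) *: x) ->
  exists2 X, weight_space s \1%VF 2 1 (a, (m%:~R, n%:~R)) X & X != 0.
Proof.
move=> x0 sx hx; have xgr : x \in graded_part s \1%VF 2 1 m n.
  by rewrite (mem_graded_part s m n x) sx.
exists (<< x *g (m, n) >>, 0, 0); last first.
  apply: contra x0 => /eqP/(congr1 (fun X => X.1.1@_(m, n))) /=.
  by rewrite mcoeffUU mcoeff0 => ->.
split.
  split=> [r /=|/=].
    by rewrite mcoeffU; case: eqP => [<-|_]; rewrite ?mem0v.
  exists 0; last exact: kpi0.
  by move=> r /=; rewrite msupp0 => -[].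
case=> [[h [a0 a1]] [c0 c1]] /=.
apply: injective_projections; last first.
  by apply: injective_projections; rewrite /= scaler0.
apply: injective_projections => /=.
  apply/malgP=> r; rewrite loop_coefZ.
  rewrite mcoeffB mcoeffD loop_lie_const (loop_deriv_const (0, 0)) mcoeff0.
  rewrite subr0 loop_deriv_coef mcoeffU; case: eqP => [<-|_] /=; last first.
    by rewrite linear0 !scaler0 addr0.
  rewrite hx -scalerDl; congr (_ *: _).
  by rewrite addrA [_ * a0]mulrC [_ * a1]mulrC.
rewrite scaler0 loop_cocycle_const k_deriv0 add0r.
by rewrite (k_deriv_const _ (c0, c1)) subr0.
Qed.

End WeightSpaces.

(** * Identification of the non-isotropic roots *)

Local Open Scope classical_set_scope.

Theorem mainTheorem11 (R : realType) (l : nat) (hl : (0 < l)%N)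
    (s0 : 'End(sl R[i] (2 * l).+1)) (hs0 : diagram_automorphism s0)
    (H : {vspace sl R[i] (2 * l).+1})
    (hH : cartan_subalgebra (graded_part s0 \1%VF 2 1 0 0) H) :
  nonisotropic_roots s0 \1%VF 2 1 H =
    [set b : root_space H | exists a : dual_space H, exists m n : int,
       lie_roots (graded_part s0 \1%VF 2 1 0 0) H a /\
       b = root_ext a + delta0 H *~ m + delta1 H *~ n]
    `|`
    [set b : root_space H | exists a : dual_space H, exists m n : int,
       short_roots (graded_part s0 \1%VF 2 1 0 0) H a /\
       b = root_ext (a *+ 2) + delta0 H *~ (2 * m + 1) + delta1 H *~ n].
Proof.
set G := graded_part s0 \1%VF 2 1 0 0 in hH *.
have en : ~~ odd (2 * l) by rewrite mul2n odd_double.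
have n0 : (0 < 2 * l)%N by rewrite muln_gt0.
have GE x : (x \in G) = (s0 x == x).
  by rewrite /G mem_graded_part expr0z scale1r.
have [sHG subH nilH selfH] := hH.
have sH h : h \in H -> s0 h = h.
  by move=> hh; apply/eqP; rewrite -GE (subvP sHG).
have {hH} [P [tau [i0 [Pu tauK tau_fix PJP HE]]]] :=
  fixed_cartan_structure en hs0 GE hH.
clearbody G.
have oddP := odd_weightP en n0 hs0 sH Pu tauK tau_fix PJP HE GE.
have root_norm := root_norm_neq0 en hs0 sH Pu tauK tau_fix PJP HE GE.
have short_norm :=
  double_short_norm_neq0 en n0 hs0 sH Pu tauK tau_fix PJP HE GE.
apply/seteqP; split=> b.
  case=> bb [X wX X0]; have b0 := dual_form_neq0 bb.
  have [m [n [x [b2E x0 sx hx]]]] := weight_space_component b0 wX X0.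
  have bE : b = root_ext b.1 + delta0 H *~ m + delta1 H *~ n.
    by rewrite root_extE -b2E -surjective_pairing.
  (* Even m puts x in the fixed subalgebra, so b.1 is one of its roots; odd m puts x in the
     eigenspace of -1, where doubled short roots also occur. *)
  have [m' [mE|mE]] := int_even_or_odd m; rewrite mE in sx.
    left; exists b.1, m, n; split=> //; split=> //; exists x; split=> //.
    by rewrite GE sx exprN1_even scale1r.
  have : weight_vector s0 (-1) b.1.
    by exists x; split=> //; rewrite sx exprN1_odd.
  case/(oddP _ b0) => [b1|[a ashort aE]]; first by left; exists b.1, m, n.
  by right; exists a, m', n; rewrite -mE -aE.
case=> [[a [m [n [aroot ->]]]]|[a [m [n [ashort ->]]]]]; rewrite root_extE.
  split; first exact: root_norm.
  have a0 := dual_form_neq0 (root_norm a aroot).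
  have [m' [mE|mE]] := int_even_or_odd m.
    case: aroot => _ [x [xG x0 hx]].
    apply: (weight_space_of_component _ x0 _ hx).
    by rewrite mE exprN1_even scale1r; apply/eqP; rewrite -GE.
  (* For odd m the root vector in the fixed subalgebra does not serve; one in the eigenspace of -1
     is taken instead. *)
  have [x [x0 sx hx]] := (oddP a a0).2 (or_introl aroot).
  apply: (weight_space_of_component _ x0 _ hx).
  by rewrite mE exprN1_odd sx.
have a0 := dual_form_neq0 (short_norm a ashort).
split; first exact: short_norm.
have [|x [x0 sx hx]] := (oddP _ a0).2; first by right; exists a.
apply: (weight_space_of_component _ x0 _ hx).
by rewrite exprN1_odd sx.
Qed.
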